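(* Let $\omega$ be a concave modulus of continuity such that for some $\varepsilon>0$ $$\int_0^{\varepsilon}\frac{\omega(t)}{t}\,dt<\infty .$$ Then: 1. $$\sup_{f\in H_\omega}\|\widetilde f\|_C=\frac1\pi\int_0^{\pi/2}\frac{\omega(2t)}{\sin t}\,dt .$$ 2. For every $t$ with $0<t<2\pi$, $$\sup_{f\in H_\omega}\max_{x}\bigl|\widetilde f(x+t)-\widetilde f(x)\bigr|=\frac2\pi\int_0^{t/2}\frac{\sin (t/2)}{\cos u-\cos (t/2)}\,\omega(\rho(u)-u)\,du,$$ where, for $0<x<t/2$, the number $\rho(x)\in(t/2,\pi)$ is defined by the equation $$\int_0^{x}\frac{\sin (t/2)}{\cos u-\cos (t/2)}\,du=-\int_{\rho(x)}^{\pi}\frac{\sin (t/2)}{\cos u-\cos (t/2)}\,du .$$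
   Context: A modulus of continuity is a function $\omega:[0,\infty)\to[0,\infty)$ that is continuous, nondecreasing, subadditive, with $\omega(0)=0$. For a $2\pi$-periodic function $f:\mathbb R\to\mathbb R$, its modulus of continuity is $\omega(f,t)=\sup_{|x-y|\le t}|f(x)-f(y)|$. $H_\omega$ is the class of $2\pi$-periodic functions $f:\mathbb R\to\mathbb R$ with $\omega(f,t)\le\omega(t)$ for all $t\ge0$. $\widetilde f$ denotes the trigonometrically conjugate function of $f$, given by the Cauchy principal value integral $$\widetilde f(x)=-\frac1\pi\,(P)\!\int_{-\pi}^{\pi}\frac{f(t)}{2\tan\frac{t-x}{2}}\,dt,$$ where the integral is extended by $2\pi$-periodicity and the principal value is taken at the singularity $t=x$ (so that $\widetilde{\cos mx}=\sin mx$, $\widetilde{\sin mx}=-\cos mx$ for $m\ge1$, and the conjugate of a constant is $0$). $\|g\|_C=\max_x|g(x)|$. *)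

(* Defs.v *)
From HB Require Import structures.
From mathcomp Require Import all_boot all_order all_algebra.
From mathcomp Require Import all_classical all_reals all_analysis.

Set Implicit Arguments.
Unset Strict Implicit.
Unset Printing Implicit Defensive.

Import Order.TTheory GRing.Theory Num.Theory.
Import numFieldNormedType.Exports.

Local Open Scope classical_set_scope.
Local Open Scope ring_scope.

Section defs.
Context {R : realType}.
Implicit Types (omega f g : R -> R) (t x u : R).

Local Notation mu := (@lebesgue_measure R).

(* Functions on [0, +oo) are represented by total functions on R of which only
   the restriction to [0, +oo) matters. *)
Definition modulus_of_continuity omega : Prop :=
  [/\ {within `[0, +oo[, continuous omega},
      {in `[0, +oo[, forall t, 0 <= omega t},
      {in `[0, +oo[ &, nondecreasing_fun omega},
      {in `[0, +oo[ &, forall s t, omega (s + t) <= omega s + omega t} &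
      omega 0 = 0].

Definition concave_on (D : set R) omega : Prop :=
  convex_function D (fun t => - omega t).

(* Extended-real valued, so that it is +oo when f is unbounded. *)
Definition omega_of f t : \bar R :=
  ereal_sup [set `|f p.1 - f p.2|%:E | p in [set p : R * R | `|p.1 - p.2| <= t]].

Definition H_ omega : set (R -> R) :=
  [set f | periodic f (pi *+ 2) /\
           forall t, 0 <= t -> (omega_of f t <= (omega t)%:E)%E].

(* The period (-pi, pi) is translated to (x - pi, x + pi), so that the kernel
   has a single singularity t = x, and its delta-neighbourhood is removed. *)
Definition conj_trunc f x (delta : R) : R :=
  - pi^-1 * \int[mu]_(t in [set t | delta <= `|t - x| <= pi])
              (f t / (2 * tan ((t - x) / 2))).

Definition conj_fun f x : R := lim (conj_trunc f x delta @[delta --> 0^'+]).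

Definition max_abs g : \bar R := ereal_sup (range (fun x => `|g x|%:E)).

Definition max_abs_attained g : Prop := exists x, max_abs g = `|g x|%:E.

Definition diff_kernel t u : R := sin (t / 2) / (cos u - cos (t / 2)).

Definition rho_spec t x : set R :=
  [set r | t / 2 < r < pi /\
     \int[mu]_(u in `[0, x]) diff_kernel t u =
     - \int[mu]_(u in `[r, pi]) diff_kernel t u].

End defs.

(* Main.v *)
Require Import Defs.
From HB Require Import structures.
From mathcomp Require Import all_boot all_order all_algebra.
From mathcomp Require Import all_classical all_reals all_analysis.
From mathcomp Require Import measurable_realfun ring lra.

Import Order.TTheory GRing.Theory Num.Theory.
Import numFieldNormedType.Exports.

Local Open Scope classical_set_scope.
Local Open Scope ring_scope.

Set Implicit Arguments.
Unset Strict Implicit.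
Unset Printing Implicit Defensive.

(** Why the theorem is true.

    For [f] in the class, [f (x + s) - f (x - s)] is at most [2 * omega s] and
    the half cotangent is at most [1 / s], so Dini's condition makes the
    truncated integrals converge uniformly in [x]; the conjugate function is
    therefore continuous and periodic, and attains its maxima ([dini_tail],
    [conj_fun_tail], [conj_fun_continuous]).

    Increments.  Put [h = t / 2].  Symmetrizing [f] about the midpoint of
    [x] and [x + t] turns the increment into twice the conjugate at [h] of an
    even function [g] ([conj_fun_symmetrization]).  For even [g], folding the
    period onto [0, pi] gives [pi * conj_fun g h] as the principal value of the
    integral of [g * kern h] over [0, pi], where [kern h] is positive on
    (0, h), negative on (h, pi) and has principal value zero
    ([sym_diff_kern]).  In the coordinate [y = tan (u / 2) / tan (h / 2)] the
    measure [kern h u du] is [2 dy / (1 - y ^ 2)], which [y |-> 1 / y] sends to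
    its opposite.  Hence [rho] is explicit, it is the map [partner h], and it
    matches the positive mass with the negative one, so that
    [pi * conj_fun g h] is the integral over (0, h) of
    [(g u - g (rho u)) * kern h u] ([cvg_conj_pairing]).  The upper bound is
    then immediate.

    Sharpness.  The intervals [u, rho u] are nested and their lengths take all
    values in [0, pi].  A function decreasing with slope 1 on the interval of
    length [c] and constant elsewhere satisfies
    [F u - F (rho u) = min (rho u - u) c] for all [u] at once, and its
    differences at distance [s] are at most [min s c].  Nonnegative
    combinations of such layers therefore realize every nonnegative combination
    [w] of the functions [min s c] ([layeredD]).  Concavity provides such a [w]
    below [omega] and uniformly close to it on [0, pi]
    ([concave_min_approximation]), and composing with the 1-Lipschitz map
    [acos \o cos] produces even periodic members of the class
    ([extremal_function]).  Letting the mesh of the approximation go to zero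
    gives the lower bound ([increment_lower]).

    Maxima of the conjugate function.  Pairing [s] with [pi - s] in the integral
    of symmetric differences turns the half cotangent into [1 / sin s] and gives
    the upper bound ([conj_fun_upper]).  The lower bound is the case [t = pi] of
    the increments, where [rho u = pi - u] and the kernel is [1 / cos u], because
    an increment is at most twice the maximum ([conj_fun_lower]). *)

Local Notation mu := (@lebesgue_measure _).
Local Notation Int a b f := (Rintegral mu `[a, b]%classic f).

(** * Integrals of continuous functions over compact intervals *)

Section compact_integrals.
Context {R : realType}.
Implicit Types (f g F G : R -> R) (a b c x : R).

(** Continuity is two-sided also at the endpoints, so that it composes pointwise
    with the changes of variable used below. *)
Definition continuous_on a b f := forall x, a <= x <= b -> {for x, continuous f}.

Lemma continuous_on_within a b f : continuous_on a b f ->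
  {within `[a, b], continuous f}.
Proof.
move=> cf; apply: continuous_in_subspaceT => x.
by rewrite inE /= in_itv/=; exact: cf.
Qed.

Lemma continuous_onS a b c d f : c <= a -> b <= d ->
  continuous_on c d f -> continuous_on a b f.
Proof. by move=> ca bd cf x /andP[ax xb]; apply: cf; lra. Qed.

Lemma continuous_onM a b f g : continuous_on a b f -> continuous_on a b g ->
  continuous_on a b (fun x => f x * g x).
Proof. by move=> cf cg x xab; apply: cvgM; [exact: cf|exact: cg]. Qed.

Lemma continuous_onT a b f : continuous f -> continuous_on a b f.
Proof. by move=> cf x _; exact: cf. Qed.

Lemma continuous_on_integrable a b f : continuous_on a b f ->
  mu.-integrable `[a, b] (EFin \o f).
Proof.
move=> cf; apply: continuous_compact_integrable; first exact: segment_compact.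
exact: continuous_on_within.
Qed.

Lemma eq_Int a b f g : (forall x, a <= x <= b -> f x = g x) ->
  Int a b f = Int a b g.
Proof.
by move=> fg; apply: eq_Rintegral => x; rewrite inE/= in_itv/=; exact: fg.
Qed.

Lemma Int_point a f : Int a a f = 0.
Proof. by rewrite set_itv1 Rintegral_set1. Qed.

Lemma Int_cat a b c f : a <= b -> b <= c -> continuous_on a c f ->
  Int a c f = Int a b f + Int b c f.
Proof.
move=> ab bc /continuous_on_integrable cf.
have := @Rintegral_itvB _ f (BLeft a) (BRight c) b cf.
rewrite !bnd_simp => /(_ ab bc).
rewrite Rintegral_itv_obnd_cbnd; first by move=> <-; ring.
apply: integrableS cf => //.
by apply: subset_itvr; rewrite bnd_simp.
Qed.

Lemma IntD a b f g : continuous_on a b f -> continuous_on a b g ->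
  Int a b (fun x => f x + g x) = Int a b f + Int a b g.
Proof.
by move=> cf cg; apply: RintegralD => //; exact: continuous_on_integrable.
Qed.

Lemma IntB a b f g : continuous_on a b f -> continuous_on a b g ->
  Int a b (fun x => f x - g x) = Int a b f - Int a b g.
Proof.
by move=> cf cg; apply: RintegralB => //; exact: continuous_on_integrable.
Qed.

Lemma IntZ a b c f : continuous_on a b f ->
  Int a b (fun x => c * f x) = c * Int a b f.
Proof. by move=> cf; apply: RintegralZl => //; exact: continuous_on_integrable. Qed.

Lemma IntN a b f : continuous_on a b f ->
  Int a b (fun x => - f x) = - Int a b f.
Proof.
by move=> cf; rewrite -mulN1r -IntZ//; apply: eq_Int => x _; rewrite mulN1r.
Qed.

Lemma le_Int a b f g : continuous_on a b f -> continuous_on a b g ->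
  (forall x, a <= x <= b -> f x <= g x) -> Int a b f <= Int a b g.
Proof.
by move=> cf cg fg; apply: le_Rintegral => //; exact: continuous_on_integrable.
Qed.

Lemma Int_ge0 a b f : (forall x, a <= x <= b -> 0 <= f x) -> 0 <= Int a b f.
Proof. by move=> f0; apply: Rintegral_ge0 => x /=; rewrite in_itv/=; exact: f0. Qed.

Lemma Int_cst a b c : a <= b -> Int a b (fun=> c) = c * (b - a).
Proof.
move=> ab; rewrite Rintegral_cst//.
transitivity (c * fine (mu `[a, b])); first by [].
rewrite lebesgue_measure_itv/= lte_fin.
move: ab; rewrite le_eqVlt => /predU1P[->|ab]; first by rewrite ltxx subrr.
by rewrite ab.
Qed.

Lemma normr_Int_le a b f g : continuous_on a b f -> continuous_on a b g ->
  (forall x, a <= x <= b -> `|f x| <= g x) -> `|Int a b f| <= Int a b g.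
Proof.
move=> cf cg fg; rewrite ler_norml -IntN//; apply/andP; split; apply: le_Int => //.
- by move=> x /cg gx; apply: cvgN.
- by move=> x /fg; rewrite ler_norml => /andP[].
- by move=> x /fg; rewrite ler_norml => /andP[].
Qed.

Lemma normr_Int_le_cst a b M f : a <= b -> continuous_on a b f ->
  (forall x, a <= x <= b -> `|f x| <= M) -> `|Int a b f| <= M * (b - a).
Proof.
by move=> ab cf fM; rewrite -Int_cst//; apply: normr_Int_le => // x _; exact: cvg_cst.
Qed.

Section substitution.
Variables (F F' G : R -> R) (a b : R).
Hypotheses (ab : a <= b)
  (dF : forall x, a <= x <= b -> is_derive x 1 F (F' x))
  (cF' : continuous_on a b F').

Let derF x : a <= x <= b -> (derive1 F) x = F' x.
Proof. by move=> /dF dFx; rewrite derive1E; apply: derive_val. Qed.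

Let cF : continuous_on a b F.
Proof.
by move=> x /dF dFx; apply/differentiable_continuous/derivable1_diffP.
Qed.

Let dF_continuous : {in `]a, b[, continuous (derive1 F)}.
Proof.
move=> x; rewrite in_itv/= => /andP[ax xb].
rewrite /continuous_at derF ?(ltW ax) ?(ltW xb)//.
have := @cF' x; rewrite !ltW// => /(_ isT).
apply: cvg_trans; apply: near_eq_cvg.
near=> y; rewrite derF//.
have : y \in `]a, b[ by near: y; apply: near_in_itvoo; rewrite in_itv/= ax xb.
by rewrite in_itv/= => /andP[/ltW-> /ltW->].
Unshelve. all: by end_near. Qed.

Let dF_right : a < b -> cvg (derive1 F x @[x --> a^'+]).
Proof.
move=> lab; apply/cvg_ex; exists (F' a).
have := @cF' a; rewrite lexx ab => /(_ isT) /cvg_at_right_filter.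
apply: cvg_trans; apply: near_eq_cvg.
near=> y; rewrite derF//; apply/andP; split; near: y.
  exact: nbhs_right_ge.
exact: nbhs_right_le.
Unshelve. all: by end_near. Qed.

Let dF_left : a < b -> cvg (derive1 F x @[x --> b^'-]).
Proof.
move=> lab; apply/cvg_ex; exists (F' b).
have := @cF' b; rewrite lexx ab => /(_ isT) /cvg_at_left_filter.
apply: cvg_trans; apply: near_eq_cvg.
near=> y; rewrite derF//; apply/andP; split; near: y.
  exact: nbhs_left_ge.
exact: nbhs_left_le.
Unshelve. all: by end_near. Qed.

Let dF_oo : derivable_oo_LRcontinuous F a b.
Proof.
split.
- move=> x; rewrite in_itv/= => /andP[ax xb].
  have : is_derive x 1 F (F' x) by apply: dF; rewrite !ltW.
  by move=> [].
- by apply: cvg_at_right_filter; apply: cF; rewrite lexx ab.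
- by apply: cvg_at_left_filter; apply: cF; rewrite lexx ab.
Qed.

Lemma Int_subst_decreasing : {in `[a, b] &, {homo F : x y /~ x < y}} ->
  continuous_on (F b) (F a) G ->
  Int (F b) (F a) G = Int a b (fun x => G (F x) * - F' x).
Proof.
move: (ab); rewrite le_eqVlt => /predU1P[<- _ _|lab Fdecr cG]; first by rewrite !Int_point.
rewrite /Rintegral (integration_by_substitution_decreasing ab)//; last first.
- exact: continuous_on_within.
- exact: dF_left.
- exact: dF_right.
congr fine; apply: eq_integral => x; rewrite inE/= in_itv/= => xab.
by rewrite !fctE derF.
Qed.

Lemma Int_subst_increasing : {in `[a, b] &, {homo F : x y / x < y}} ->
  continuous_on (F a) (F b) G ->
  Int (F a) (F b) G = Int a b (fun x => G (F x) * F' x).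
Proof.
move: (ab); rewrite le_eqVlt => /predU1P[<- _ _|lab Fincr cG]; first by rewrite !Int_point.
rewrite /Rintegral (integration_by_substitution_increasing ab)//; last first.
- exact: continuous_on_within.
- exact: dF_left.
- exact: dF_right.
congr fine; apply: eq_integral => x; rewrite inE/= in_itv/= => xab.
by rewrite !fctE derF.
Qed.

End substitution.

Lemma Int_reflect c a b f : a <= b -> continuous_on (c - b) (c - a) f ->
  Int a b (fun x => f (c - x)) = Int (c - b) (c - a) f.
Proof.
move=> ab cf.
have dF x : a <= x <= b -> is_derive x 1 (fun x => c - x) (- 1).
  by move=> _; rewrite -[X in is_derive _ _ _ X]add0r; apply: is_deriveB.
rewrite (Int_subst_decreasing ab dF) //.
- by apply: eq_Int => x _; rewrite opprK mulr1.
- by move=> x _; exact: cvg_cst.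
- by move=> x y _ _ xy; rewrite ltrD2l ltrN2.
Qed.

Lemma Int_reflectE c a b a' b' f : a <= b -> a' = c - b -> b' = c - a ->
  continuous_on a' b' f -> Int a' b' f = Int a b (fun x => f (c - x)).
Proof. by move=> ab -> -> cf; rewrite Int_reflect. Qed.

Lemma Int_shift c a b f : a <= b -> continuous_on (c + a) (c + b) f ->
  Int a b (fun x => f (c + x)) = Int (c + a) (c + b) f.
Proof.
move=> ab cf.
have dF x : a <= x <= b -> is_derive x 1 (fun x => c + x) 1.
  by move=> _; rewrite -[X in is_derive _ _ _ X]add0r; apply: is_deriveD.
rewrite (Int_subst_increasing ab dF) //.
- by apply: eq_Int => x _; rewrite mulr1.
- by move=> x _; exact: cvg_cst.
- by move=> x y _ _ xy; rewrite ltrD2l.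
Qed.

End compact_integrals.

(** * Exhausting an open interval *)

Section exhaustion.
Context {R : realType}.
Implicit Types (f : R -> R) (a b c d x : R).

Let measurable_oo a b f : (forall x, a < x < b -> {for x, continuous f}) ->
  measurable_fun `]a, b[%classic f.
Proof.
move=> cf; apply: subspace_continuous_measurable_fun => //.
by apply: continuous_in_subspaceT => x; rewrite inE/= in_itv/=; exact: cf.
Qed.

Lemma EFin_Int a b f : continuous_on a b f ->
  (Int a b f)%:E = (\int[mu]_(x in `]a, b[) (f x)%:E)%E.
Proof.
move=> cf; rewrite -(@integral_itv_bndoo _ a b (EFin \o f) true false); last first.
  apply/measurable_EFinP; apply: measurable_oo => x /andP[ax xb].
  by apply: cf; rewrite !ltW.
by rewrite /Rintegral fineK// integrable_fin_num//; exact: continuous_on_integrable.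
Qed.

(** Together with [open_integral_le], this replaces limit theorems for integrals:
    an integral over an open interval, possibly infinite, is compared with a
    real number through compact subintervals only. *)
Lemma Int_le_open_integral a b c d f : a <= c -> d <= b ->
  continuous_on c d f ->
  (forall x, a < x < b -> {for x, continuous f}) ->
  (forall x, a < x < b -> 0 <= f x) ->
  ((Int c d f)%:E <= \int[mu]_(x in `]a, b[) (f x)%:E)%E.
Proof.
move=> ac db cdf cf f0; rewrite EFin_Int//; apply: ge0_subset_integral => //.
- by apply/measurable_EFinP; exact: measurable_oo.
- exact: subset_itvW.
Qed.

(** Monotone convergence along compact intervals exhausting (a, b). *)
Lemma open_integral_le a b f (M : R) : a < b ->
  (forall x, a < x < b -> {for x, continuous f}) ->
  (forall x, a < x < b -> 0 <= f x) ->
  (forall c d, a < c -> c <= d -> d < b -> Int c d f <= M) ->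
  (\int[mu]_(x in `]a, b[) (f x)%:E <= M%:E)%E.
Proof.
move=> ab cf f0 fM.
(* the margins shrink from half the length, so the first interval is a point *)
pose w := (b - a) / 2.
have w0 : 0 < w by rewrite /w; lra.
pose e n : R := w * n.+1%:R^-1.
have e0 n : 0 < e n by rewrite mulr_gt0// invr_gt0.
have ew n : e n <= w by rewrite ler_piMr ?(ltW w0)// invf_le1// ler1n.
pose F n := `[a + e n, b - e n]%classic.
have FU : \bigcup_n F n = `]a, b[%classic.
  apply/seteqP; split => [x [n _] /=|x /=]; rewrite !in_itv/=.
    by move=> /andP[]; rewrite !bnd_simp; have := e0 n; lra.
  move=> /andP[ax xb].
  have m0 : 0 < Num.min (x - a) (b - x) / w by rewrite divr_gt0// lt_min; lra.
  have [N _ /(_ N (leqnn N))] := near_infty_natSinv_lt (PosNum m0).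
  rewrite /= ltr_pdivlMr// mulrC -/(e N) lt_min => /andP[h1 h2].
  by exists N => //; rewrite /F/= in_itv/=; apply/andP; split; lra.
have mF n : measurable (F n) by exact: measurable_itv.
have ndF : nondecreasing_seq F.
  move=> m n mn; rewrite subsetEset; apply: subset_itv; rewrite bnd_simp.
    by rewrite lerD2l ler_pM2l// lef_pV2 ?posrE// ler_nat.
  by rewrite lerD2l lerN2 ler_pM2l// lef_pV2 ?posrE// ler_nat.
have FS n x : F n x -> a < x < b.
  by rewrite /F/= in_itv/= => /andP[]; rewrite ?bnd_simp; have := e0 n; lra.
have H : (\int[mu]_(x in F i) (f x)%:E)%E @[i --> \oo] -->
         (\int[mu]_(x in `]a, b[) (f x)%:E)%E.
  rewrite -FU; apply: ge0_nondecreasing_set_cvg_integral => //.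
    move=> n; apply/measurable_EFinP; apply: measurable_funS (measurable_oo cf) => // x /FS.
    by rewrite /= in_itv.
  by move=> n x /FS; rewrite lee_fin => /f0.
rewrite -(cvg_lim _ H)//; apply: lime_le; first by apply/cvg_ex; eexists; exact: H.
near=> n.
have cfn : continuous_on (a + e n) (b - e n) f.
  by move=> x ?; apply: cf; have := e0 n; lra.
rewrite -(@fineK _ (\int[mu]_(x in F n) (f x)%:E)%E).
  rewrite lee_fin; apply: fM; have := e0 n; have := ew n; rewrite /w; lra.
by apply: integrable_fin_num; [exact: mF|exact: (continuous_on_integrable cfn)].
Unshelve. all: by end_near. Qed.

End exhaustion.

(** * The half cotangent and the class H_omega *)

Section half_cotangent.
Context {R : realType}.
Implicit Types (s x y : R).

Definition half_cot (s : R) : R := cos (s / 2) / (2 * sin (s / 2)).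

(** Holds for every [s], because [x / 0 = 0] makes both sides vanish
    where the sine or the cosine does. *)
Lemma invr_2tan s : (2 * tan (s / 2))^-1 = half_cot s.
Proof. by rewrite /half_cot /tan !invfM invrK; ring. Qed.

Lemma half_cotN s : half_cot (- s) = - half_cot s.
Proof. by rewrite /half_cot mulNr cosN sinN mulrN invrN mulrN. Qed.

Lemma half_cot2piB s : half_cot (2 * pi - s) = - half_cot s.
Proof.
rewrite /half_cot (_ : (2 * pi - s) / 2 = - (s / 2) + pi); last by field.
by rewrite cosDpi sinDpi cosN sinN opprK mulNr.
Qed.

Lemma half_cotBpi s : half_cot (pi - s) = sin (s / 2) / (2 * cos (s / 2)).
Proof.
rewrite /half_cot (_ : (pi - s) / 2 = - (s / 2) + pi / 2); last by field.
by rewrite cosDpihalf sinDpihalf cosN sinN opprK.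
Qed.

Lemma sin_half_gt0 s : 0 < s < 2 * pi -> 0 < sin (s / 2).
Proof. by move=> ?; apply: sin_gt0_pi; lra. Qed.

Lemma continuous_sin_half s : {for s, continuous (fun s => sin (s / 2) : R)}.
Proof.
apply: (@continuous_comp _ _ _ (fun s => s / 2) sin); last exact: continuous_sin.
exact: mulrr_continuous.
Qed.

Lemma continuous_cos_half s : {for s, continuous (fun s => cos (s / 2) : R)}.
Proof.
apply: (@continuous_comp _ _ _ (fun s => s / 2) cos); last exact: continuous_cos.
exact: mulrr_continuous.
Qed.

Lemma half_cot_continuous s : 0 < s < 2 * pi -> {for s, continuous half_cot}.
Proof.
move=> /sin_half_gt0 s0; apply: cvgM; first exact: continuous_cos_half.
apply: cvgV; first by rewrite mulf_neq0// gt_eqF.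
by apply: cvgM; [exact: cvg_cst|exact: continuous_sin_half].
Qed.

Lemma half_cot_ge0 s : 0 < s <= pi -> 0 <= half_cot s.
Proof.
move=> s0; have p0 := pi_gt0 R; rewrite divr_ge0//.
  by rewrite cos_ge0_pihalf//; lra.
by rewrite mulr_ge0// ltW// sin_half_gt0//; lra.
Qed.

Lemma mul_cos_le_sin x : 0 < x <= pi -> x * cos x <= sin x.
Proof.
move=> /andP[x0 xpi].
have [c] := MVT x0 (fun y _ => is_derive_sin y) (continuous_subspaceT (@continuous_sin R)).
rewrite in_itv/= sin0 !subr0 => /andP[c0 cx] ->; rewrite mulrC ler_wpM2r ?(ltW x0)//.
by rewrite ltW// ltr_cos ?in_itv/= ?(ltW x0) ?(ltW c0)//; lra.
Qed.

(** This is [tan x >= x] on the first quadrant. *)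
Lemma half_cot_le s : 0 < s <= pi -> half_cot s <= s^-1.
Proof.
move=> s0; have p0 := pi_gt0 R.
have sn : 0 < sin (s / 2) by apply: sin_half_gt0; lra.
rewrite /half_cot ler_pdivrMr ?mulr_gt0// [leRHS]mulrC ler_pdivlMr; last lra.
have := @mul_cos_le_sin (s / 2) ltac:(lra).
lra.
Qed.

End half_cotangent.

Section modulus.
Context {R : realType}.
Variable omega : R -> R.
Hypothesis omega_modulus : modulus_of_continuity omega.
Implicit Types (f g : R -> R) (s t x y : R).

Lemma modulus0 : omega 0 = 0. Proof. by case: omega_modulus. Qed.

Lemma modulus_ge0 s : 0 <= s -> 0 <= omega s.
Proof. by case: omega_modulus => _ + _ _ _ s0; apply; rewrite in_itv/= s0. Qed.

Lemma modulus_le s t : 0 <= s -> s <= t -> omega s <= omega t.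
Proof.
case: omega_modulus => _ _ + _ _ s0 st; apply => //; rewrite in_itv/= andbT//.
exact: le_trans st.
Qed.

Lemma modulusD s t : 0 <= s -> 0 <= t -> omega (s + t) <= omega s + omega t.
Proof.
by case: omega_modulus => _ _ _ + _ s0 t0; apply; rewrite in_itv/= andbT.
Qed.

Lemma modulus_small (e : R) : 0 < e ->
  exists2 d : R, 0 < d & forall s, 0 <= s -> s <= d -> omega s <= e.
Proof.
move=> e0; case: omega_modulus => /continuous_within_itvcyP[_ + ] _ _ _ _.
rewrite modulus0 => /cvgr0Pnorm_le /(_ _ e0)[d /= d0 dP].
exists (d / 2); first by rewrite divr_gt0.
move=> s; rewrite le_eqVlt => /predU1P[<- _|s0 sd].
  by rewrite modulus0 ltW.
apply: le_trans (dP s _ s0); first exact: ler_norm.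
by rewrite /= sub0r normrN gtr0_norm//; lra.
Qed.

Definition modulated f := forall x y, `|f x - f y| <= omega `|x - y|.

Lemma modulated_continuous f : modulated f -> continuous f.
Proof.
move=> fP x; apply/cvgrPdist_le => e /modulus_small[d d0 dP].
near=> y; apply: le_trans (fP _ _) _; apply: dP => //.
Unshelve. all: by end_near. Qed.

(** The modulus extended evenly is modulated by itself; through
    [modulated_continuous] this yields two-sided continuity everywhere. *)
Lemma modulated_modulus : modulated (fun s => omega `|s|).
Proof.
move=> x y; rewrite ler_norml; apply/andP; split.
  rewrite lerBrDr addrC lerBlDr; apply: le_trans (modulusD _ _) => //.
  by apply: modulus_le => //; rewrite distrC -{1}(subrK x y) addrC ler_normD.
rewrite lerBlDr; apply: le_trans (modulusD _ _) => //.
by apply: modulus_le => //; rewrite -{1}(subrK y x) ler_normD.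
Qed.

Lemma continuous_modulus_norm : continuous (fun s => omega `|s|).
Proof. exact: modulated_continuous modulated_modulus. Qed.

Lemma H_P f : H_ omega f <-> periodic f (pi *+ 2) /\ modulated f.
Proof.
split=> -[pf fP]; split => //.
  move=> x y; have := fP `|x - y| (normr_ge0 _); rewrite /omega_of => h.
  rewrite -lee_fin; apply: le_trans h; apply: ereal_sup_ubound.
  by exists (x, y) => /=.
move=> t t0; apply: ge_ereal_sup => _ [[x y] /= xyt <-].
by rewrite lee_fin; apply: le_trans (fP _ _) _; apply: modulus_le.
Qed.

Lemma modulated_sym_diff f x s : modulated f -> 0 <= s ->
  `|f (x + s) - f (x - s)| <= 2 * omega s.
Proof.
move=> fP s0; apply: le_trans (fP _ _) _.
rewrite (_ : x + s - (x - s) = s + s); last by ring.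
by rewrite ger0_norm ?addr_ge0// mulr_natl mulr2n modulusD.
Qed.

End modulus.

(** * The conjugate function as an integral of symmetric differences *)

Section conjugate.
Context {R : realType}.
Implicit Types (f g : R -> R) (s t x y : R).

Definition sym_diff f x s := (f (x + s) - f (x - s)) * half_cot s.

Lemma continuous_translate f (c : R) : continuous f -> continuous (fun s => f (c + s)).
Proof.
move=> cf s; apply: (@continuous_comp _ _ _ (fun s => c + s) f); last exact: cf.
by apply: cvgD; [exact: cvg_cst|exact: cvg_id].
Qed.

Lemma continuous_reflect f (c : R) : continuous f -> continuous (fun s => f (c - s)).
Proof.
move=> cf s; apply: (@continuous_comp _ _ _ (fun s => c - s) f); last exact: cf.
by apply: cvgB; [exact: cvg_cst|exact: cvg_id].
Qed.

Lemma continuous_half_cot (a b : R) : 0 < a -> b <= pi ->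
  continuous_on a b half_cot.
Proof.
by move=> a0 bpi s ?; apply: half_cot_continuous; have := pi_gt0 R; lra.
Qed.

Lemma continuous_sym_diff f x (a b : R) : continuous f -> 0 < a -> b <= pi ->
  continuous_on a b (sym_diff f x).
Proof.
move=> cf a0 bpi s sab; apply: cvgM; last exact: continuous_half_cot sab.
by apply: cvgB; [exact: continuous_translate|exact: continuous_reflect].
Qed.

(** Substituting [t = x - s] and [t = x + s] on the two halves of the truncated
    period, on which the half cotangent takes opposite values. *)
Lemma conj_truncE f x (delta : R) : continuous f -> 0 < delta -> delta <= pi ->
  conj_trunc f x delta = - pi^-1 * Int delta pi (sym_diff f x).
Proof.
move=> cf d0 dpi; have p0 := pi_gt0 R.
rewrite /conj_trunc; congr (_ * _).
have -> : [set t | delta <= `|t - x| <= pi] =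
    `[x - pi, x - delta]%classic `|` `[x + delta, x + pi]%classic.
  apply/seteqP; split => t /=; rewrite !in_itv/=.
    by case: (ger0P (t - x)) => h ?; [right|left]; lra.
  by case=> ?; case: (ger0P (t - x)) => ?; lra.
pose k t := f t * half_cot (t - x).
have ck (a b : R) : (forall t, a <= t <= b -> 0 < `|t - x| <= pi) -> continuous_on a b k.
  move=> abP t /abP tx; apply: cvgM; first exact: cf.
  apply: (@continuous_comp _ _ _ (fun s => s - x) half_cot).
    by apply: cvgB; [exact: cvg_id|exact: cvg_cst].
  have [h|h] := lerP 0 (t - x).
    by apply: half_cot_continuous; move: tx; rewrite ger0_norm//; lra.
  have -> : half_cot = (fun s : R => - half_cot (- s)).
    by apply/funext => s; rewrite half_cotN opprK.
  apply: cvgN; apply: (@continuous_comp _ _ _ (fun s => - s) half_cot).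
    by apply: cvgN; exact: cvg_id.
  by apply: half_cot_continuous; move: tx; rewrite ltr0_norm//; lra.
have c1 : continuous_on (x - pi) (x - delta) k.
  by apply: ck => t ?; rewrite ler0_norm; lra.
have c2 : continuous_on (x + delta) (x + pi) k.
  by apply: ck => t ?; rewrite ger0_norm; lra.
under eq_Rintegral do rewrite invr_2tan.
rewrite Rintegral_setU//=; last 2 first.
- apply: continuous_compact_integrable.
    by apply: compactU; exact: segment_compact.
  apply: continuous_in_subspaceT => t; rewrite inE/= !in_itv/= => -[].
    exact: c1.
  exact: c2.
- apply/disj_setPS => t [] /=; rewrite !in_itv/=; lra.
rewrite -/k -(@Int_shift _ x delta pi k)// -(@Int_reflect _ x delta pi k)//.
rewrite -IntD.
- apply: eq_Int => s _; rewrite /k /sym_diff.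
  rewrite (_ : x - s - x = - s); last by ring.
  rewrite (_ : x + s - x = s); last by ring.
  by rewrite half_cotN; ring.
- move=> s sd; apply: (@continuous_comp _ _ _ (fun s => x - s) k).
    by apply: cvgB; [exact: cvg_cst|exact: cvg_id].
  by apply: c1; lra.
- move=> s sd; apply: (@continuous_comp _ _ _ (fun s => x + s) k).
    by apply: cvgD; [exact: cvg_cst|exact: cvg_id].
  by apply: c2; lra.
Qed.

End conjugate.

(** * Convergence, continuity and attained maxima *)

Section periodic_maximum.
Context {R : realType}.
Implicit Types (f g : R -> R).

Lemma periodicz (T : R) g : periodic g T -> forall (k : int) u, g (u + T *~ k) = g u.
Proof.
move=> pg [n|n] u; first exact: periodicn.
by rewrite -(periodicn pg n.+1 (u + _)) NegzE mulrNz pmulrn subrK.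
Qed.

(** A continuous function attains its maximum on one period, and any point can
    be translated into that period. *)
Lemma max_abs_attained_periodic g : continuous g -> periodic g (pi *+ 2) ->
  max_abs_attained g.
Proof.
move=> cg pg; have p0 := pi_gt0 R.
have T0 : 0 < pi *+ 2 :> R by rewrite mulrn_wgt0.
have [c _ cP] : exists2 c, c \in `[0, pi *+ 2] &
    forall t, t \in `[0, pi *+ 2] -> `|g t| <= `|g c|.
  apply: (@EVT_max _ (fun t => `|g t|)); first exact: ltW.
  by apply: continuous_subspaceT => x; apply: cvg_norm; exact: cg.
exists c; apply/eqP; rewrite eq_le; apply/andP; split; last first.
  by apply: ereal_sup_ubound; exists c.
apply: ge_ereal_sup => _ [y _ <-]; rewrite lee_fin.
pose k := Num.floor (y / (pi *+ 2)).
rewrite -(periodicz pg (- k) y); apply: cP.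
have /andP[k1 k2] := floor_itv (y / (pi *+ 2)).
rewrite -/k in k1 k2; rewrite ler_pdivlMr// in k1; rewrite ltr_pdivrMr// in k2.
rewrite intrD mulrDl mul1r in k2.
rewrite in_itv/= mulrNz -[(pi *+ 2) *~ k]mulrzl; lra.
Qed.
End periodic_maximum.

Section conjugate_limit.
Context {R : realType}.
Variable omega : R -> R.
Hypothesis omega_modulus : modulus_of_continuity omega.
Hypothesis omega_dini : exists2 eps : R, 0 < eps &
      (\int[lebesgue_measure]_(t in `]0%R, eps[) (omega t / t)%:E < +oo)%E.
Implicit Types (f g : R -> R) (s t x y : R).

Local Notation Lip := (modulated omega).

Lemma continuous_modulus_div s : 0 < s ->
  {for s, continuous (fun s => omega `|s| / s)}.
Proof.
move=> s0; apply: cvgM; first exact: (continuous_modulus_norm omega_modulus).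
by apply: cvgV; [rewrite gt_eqF|exact: cvg_id].
Qed.

(** A compact interval carries all but [e] of the finite total integral, so
    whatever lies to its left carries at most [e]. *)
Lemma dini_tail (e : R) : 0 < e -> exists2 d : R, 0 < d <= pi &
  forall c c', 0 < c -> c <= c' -> c' <= d -> Int c c' (fun s => omega `|s| / s) <= e.
Proof.
move=> e0; have p0 := pi_gt0 R; have [eps eps0 fin] := omega_dini.
pose phi s := omega `|s| / s.
have phi_eq : (\int[mu]_(t in `]0%R, eps[) (phi t)%:E =
               \int[mu]_(t in `]0%R, eps[) (omega t / t)%:E)%E.
  by apply: eq_integral => t; rewrite inE/= in_itv/= => /andP[t0 _]; rewrite /phi gtr0_norm.
have phi0 s : 0 < s -> 0 <= phi s.
  by move=> s0; rewrite divr_ge0 ?(ltW s0)// (modulus_ge0 omega_modulus).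
set I := (\int[mu]_(t in `]0%R, eps[) (phi t)%:E)%E in phi_eq.
have I0 : (0 <= I)%E.
  by apply: integral_ge0 => t /=; rewrite in_itv/= lee_fin => /andP[/phi0].
have If : I \is a fin_num by rewrite ge0_fin_numE// phi_eq.
have [c [d [c0 cd deps big]]] : exists c d, [/\ 0 < c, c <= d, d < eps &
    fine I - e < Int c d phi].
  apply: contrapT => H.
  have : (I <= (fine I - e)%:E)%E.
    apply: open_integral_le => //.
    - by move=> x /andP[x0 _]; exact: continuous_modulus_div.
    - by move=> x /andP[x0 _]; exact: phi0.
    move=> c d c0 cd deps; rewrite leNgt; apply/negP => big.
    by apply: H; exists c, d.
  by rewrite -{1}(fineK If) lee_fin; lra.
exists (Num.min c pi); first by rewrite lt_min c0 p0 ge_min lexx orbT.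
move=> a b a0 ab; rewrite le_min => /andP[bc _].
have cphi : continuous_on a d phi.
  by move=> s ?; apply: continuous_modulus_div; lra.
have h : Int a d phi <= fine I.
  rewrite -lee_fin (fineK If).
  apply: Int_le_open_integral => //; try exact: ltW.
  - by move=> x /andP[x0 _]; exact: continuous_modulus_div.
  - by move=> x /andP[x0 _]; exact: phi0.
have split1 := @Int_cat R a c d phi ltac:(lra) cd cphi.
have split2 := @Int_cat R a b c phi ab bc (continuous_onS (lexx a) cd cphi).
have : 0 <= Int b c phi by apply: Int_ge0 => x ?; apply: phi0; lra.
rewrite -/phi; lra.
Qed.

Lemma sym_diff_le f x s : Lip f -> 0 < s <= pi ->
  `|sym_diff f x s| <= 2 * (omega `|s| / s).
Proof.
move=> fP s0; have sn : 0 <= half_cot s by exact: half_cot_ge0.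
rewrite normrM (ger0_norm sn) mulrA ler_pM//.
  by rewrite (gtr0_norm (x := s)) ?modulated_sym_diff//; lra.
exact: half_cot_le.
Qed.

(** Uniform in [f] and [x]: this gives the Cauchy criterion for the truncations,
    and later the continuity of the limit. *)
Lemma sym_diff_tail (e : R) : 0 < e -> exists2 d : R, 0 < d <= pi &
  forall f, Lip f -> forall x c c', 0 < c -> c <= c' -> c' <= d ->
   `|Int c pi (sym_diff f x) - Int c' pi (sym_diff f x)| <= e.
Proof.
move=> e0; have [d d0 dP] := @dini_tail (e / 2) ltac:(lra).
exists d => // f fP x c c' c0 cc' c'd; have cf := modulated_continuous omega_modulus fP.
rewrite (@Int_cat R c c' pi)//; [|lra|exact: continuous_sym_diff].
rewrite addrK; have h := dP c c' c0 cc' c'd.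
have := @normr_Int_le R c c' (sym_diff f x) (fun s => 2 * (omega `|s| / s)).
rewrite IntZ; last by move=> s ?; apply: continuous_modulus_div; lra.
move=> H; apply: (le_trans (H _ _ _)); last lra.
- by apply: continuous_sym_diff => //; lra.
- move=> s ?; apply: cvgM; first exact: cvg_cst.
  by apply: continuous_modulus_div; lra.
- by move=> s ?; apply: sym_diff_le => //; lra.
Qed.

Lemma cvg_conj_trunc f x : Lip f -> cvg (conj_trunc f x delta @[delta --> 0^'+]).
Proof.
move=> fP; have cf := modulated_continuous omega_modulus fP; have p0 := pi_gt0 R.
apply/cauchy_cvgP; apply: cauchy_exP => e e0.
have [d d0 dP] := @sym_diff_tail (e * pi / 2) ltac:(by rewrite divr_gt0// mulr_gt0).
exists (conj_trunc f x d); rewrite /fmapE /=.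
near=> c; rewrite /ball/=.
have c0 : 0 < c by near: c; exact: nbhs_right_gt.
have cd : c <= d by near: c; apply: nbhs_right_le; lra.
rewrite !conj_truncE//; try lra.
rewrite -mulrBr normrM normrN (ger0_norm (x := pi^-1)) ?invr_ge0 ?pi_ge0// distrC.
rewrite mulrC ltr_pdivrMr//; apply: le_lt_trans (dP f fP x c d c0 cd (lexx _)) _.
by have := mulr_gt0 e0 p0; lra.
Unshelve. all: by end_near. Qed.

Lemma cvg_sym_diff f x : Lip f ->
  Int d pi (sym_diff f x) @[d --> 0^'+] --> - pi * conj_fun f x.
Proof.
move=> fP; have cf := modulated_continuous omega_modulus fP; have p0 := pi_gt0 R.
have h : (- pi) * conj_trunc f x d @[d --> 0^'+] --> - pi * conj_fun f x.
  by apply: cvgM; [exact: cvg_cst|exact: cvg_conj_trunc].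
apply: cvg_trans h; apply: near_eq_cvg; near=> c.
rewrite conj_truncE//; [|by near: c; apply: nbhs_right_le].
by rewrite mulrA mulrNN divff ?mul1r// gt_eqF.
Unshelve. all: by end_near. Qed.

(** Identities between conjugate functions are proved on the truncations and
    transferred to the limit with this lemma. *)
Lemma conj_fun_unique f x (l : R) : Lip f ->
  Int d pi (sym_diff f x) @[d --> 0^'+] --> l -> - pi * conj_fun f x = l.
Proof. by move=> /(cvg_sym_diff (x := x)) h1 h2; exact: (cvg_unique _ h1 h2). Qed.

Lemma conj_fun_tail (e : R) : 0 < e -> exists2 d : R, 0 < d <= pi &
  forall f, Lip f -> forall x, `|Int d pi (sym_diff f x) + pi * conj_fun f x| <= e.
Proof.
move=> /sym_diff_tail[d d0 dP]; exists d => // f fP x.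
have h : `|Int d pi (sym_diff f x) - Int c pi (sym_diff f x)| @[c --> 0^'+] -->
         `|Int d pi (sym_diff f x) - (- pi * conj_fun f x)|.
  by apply: cvg_norm; apply: cvgB; [exact: cvg_cst|exact: cvg_sym_diff].
rewrite mulNr opprK in h; apply: (closed_cvg [set y | y <= e] _ _ _ h).
  exact: closed_le.
near=> c => /=.
have c0 : 0 < c by near: c; exact: nbhs_right_gt.
have cd : c <= d by near: c; apply: nbhs_right_le; lra.
by rewrite distrC; apply: dP.
Unshelve. all: by end_near. Qed.

Lemma sym_diff_lip f x y s : Lip f -> 0 < s <= pi ->
  `|sym_diff f x s - sym_diff f y s| <= 2 * omega `|x - y| / s.
Proof.
move=> fP s0; rewrite /sym_diff -mulrBl normrM ler_pM//; last first.
  by rewrite ger0_norm ?half_cot_ge0 ?half_cot_le.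
rewrite (_ : _ - _ = (f (x + s) - f (y + s)) + (f (y - s) - f (x - s))); last by ring.
apply: le_trans (ler_normD _ _) _; rewrite mulr_natl mulr2n lerD//.
  by apply: le_trans (fP _ _) _; rewrite (_ : _ - _ = x - y)//; ring.
by apply: le_trans (fP _ _) _; rewrite distrC (_ : _ - _ = x - y)//; ring.
Qed.

(** At a fixed small truncation the integrals depend continuously on [x], since
    the kernel is bounded there; the tails are uniformly small. *)
Lemma conj_fun_continuous f : Lip f -> continuous (conj_fun f).
Proof.
move=> fP x; have cf := modulated_continuous omega_modulus fP; have p0 := pi_gt0 R.
apply/cvgrPdist_le => e e0; have ep0 := mulr_gt0 e0 p0.
(* one third of the error for each tail, one for the truncated integrals *)
have [d /andP[d0 dpi] /(_ f fP) dP] := @conj_fun_tail (e * pi / 3) ltac:(lra).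
have de0 : 0 < d * e / 6 by rewrite divr_gt0// mulr_gt0.
have [r r0 rP] := modulus_small omega_modulus de0.
near=> y.
have xy : `|x - y| <= r by near: y; apply: cvgr_dist_le r0.
rewrite -(ler_pM2r p0) -[X in _ * X](gtr0_norm p0) -normrM mulrBl.
have := dP x; have := dP y.
have cD z := @continuous_sym_diff R f z d pi cf d0 (lexx _).
have := @normr_Int_le_cst R d pi (e / 3)
  (fun s => sym_diff f x s - sym_diff f y s) dpi.
rewrite IntB// => H.
have {H} : `|Int d pi (sym_diff f x) - Int d pi (sym_diff f y)| <= e / 3 * (pi - d).
  apply: H => [s sd|s sd].
    by apply: cvgB; apply: cD.
  apply: le_trans (sym_diff_lip _ _ _ _) _ => //; first lra.
  rewrite ler_pdivrMr; last lra.
  have := rP _ (normr_ge0 (x - y)) xy.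
  have : d * e <= s * e by rewrite ler_wpM2r ?(ltW e0)//; lra.
  lra.
have : 0 <= e * d by rewrite mulr_ge0 ?ltW.
rewrite !ler_norml; move: (Int d pi _) (Int d pi _) => A B.
lra.
Unshelve. all: by end_near. Qed.

Lemma conj_fun_periodic f : Lip f -> periodic f (pi *+ 2) ->
  periodic (conj_fun f) (pi *+ 2).
Proof.
move=> fP pf x; have p0 := pi_gt0 R.
have /mulfI : - pi != 0 :> R by rewrite oppr_eq0 gt_eqF.
apply; apply: conj_fun_unique => //.
rewrite (_ : sym_diff f (x + pi *+ 2) = sym_diff f x); first exact: cvg_sym_diff.
by apply/funext => s; rewrite /sym_diff (addrAC x _ s) (addrAC x _ (- s)) !pf.
Qed.

End conjugate_limit.

(** * The difference kernel and its pairing *)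

Section pairing.
Context {R : realType}.
Implicit Types (x y u h : R).

Lemma cos_tan_half x : cos (x / 2) != 0 ->
  cos x = (1 - tan (x / 2) ^+ 2) / (1 + tan (x / 2) ^+ 2).
Proof.
move=> c0; rewrite -(cos2_tan2 c0) invrK {1}(_ : x = x / 2 *+ 2); last by field.
rewrite cos_mulr2n mulrBl mul1r -exprMn /tan divfK// sin2cos2; ring.
Qed.

Lemma sin_tan_half x : cos (x / 2) != 0 ->
  sin x = 2 * tan (x / 2) / (1 + tan (x / 2) ^+ 2).
Proof.
move=> c0; rewrite -(cos2_tan2 c0) invrK {1}(_ : x = x / 2 *+ 2); last by field.
by rewrite sin_mulr2n /tan; field.
Qed.

Lemma cos_half_gt0 x : - pi < x < pi -> 0 < cos (x / 2).
Proof. by move=> ?; apply: cos_gt0_pihalf; lra. Qed.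

Lemma tan_pihalfB x : tan (pi / 2 - x) = (tan x)^-1.
Proof.
by rewrite /tan addrC sinDpihalf cosDpihalf sinN cosN opprK invf_div.
Qed.

Lemma is_derive_mulr (g : R -> R) (c x b : R) :
  is_derive x 1 g b -> is_derive x 1 (fun x => g x * c) (b * c).
Proof.
move=> dg; rewrite (_ : (fun _ => _) = c \*: g).
  by rewrite mulrC; exact: is_deriveZ.
by apply/funext => y; rewrite mulrC.
Qed.

Lemma is_derive_tan_half x : cos (x / 2) != 0 ->
  is_derive x 1 (fun x => tan (x / 2)) (cos (x / 2) ^- 2 * 2^-1).
Proof.
move=> c0; have dhalf : is_derive x 1 (fun x : R => x / 2) (2^-1).
  by rewrite -[X in is_derive _ _ _ X]mul1r; apply: is_derive_mulr.
exact: (@is_derive1_comp _ tan _ x _ _ (is_derive_tan c0) dhalf).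
Qed.

Section fixed_h.
Variable h : R.
Hypothesis h0pi : 0 < h < pi.

Local Ltac lrah := move: h0pi (pi_gt0 R) => *; lra.

(** [diff_kernel t] is [kern (t / 2)]. *)
Definition kern u := sin h / (cos u - cos h).

Definition partner_slope x :=
  - (tan (h / 2) ^+ 2 * (1 + tan (x / 2) ^+ 2) /
     (tan (h / 2) ^+ 4 + tan (x / 2) ^+ 2)).

(** The map [rho] of the theorem.  It is characterized by
    [tan (x / 2) * tan (rho x / 2) = tan (h / 2) ^ 2]; this form, with the
    arctangent of the inverse ratio, is also correct at [x = 0], where [rho] is [pi]. *)
Definition partner x := pi - 2 * atan (tan (x / 2) / tan (h / 2) ^+ 2).

Let T_gt0 : 0 < tan (h / 2).
Proof.
rewrite /tan divr_gt0//; last by apply: cos_half_gt0; lrah.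
by apply: sin_gt0_pi; lrah.
Qed.

Let in_tan x : - pi < x < pi -> (x / 2) \in `](- (pi / 2)), (pi / 2)[.
Proof. by move=> ?; rewrite in_itv/=; lrah. Qed.

Lemma partner0 : partner 0 = pi.
Proof. by rewrite /partner mul0r tan0 mul0r atan0 mulr0 subr0. Qed.

Lemma partner_h : partner h = h.
Proof.
rewrite /partner expr2 invfM mulrA divff ?gt_eqF// mul1r -tan_pihalfB tanK.
  by field.
by rewrite in_itv/=; lrah.
Qed.

Lemma partner_decreasing x y : - pi < x -> x < y -> y < pi -> partner y < partner x.
Proof.
move=> x0 xy ypi; rewrite ltrD2l ltrN2 ltr_pM2l// lt_atan//.
by rewrite ltr_pM2r ?invr_gt0 ?exprn_gt0// ltr_tan ?in_tan//; lrah.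
Qed.

Lemma partner_gt x : 0 <= x < h -> h < partner x.
Proof. by move=> ?; rewrite -{1}partner_h partner_decreasing//; lrah. Qed.

Lemma partner_le x : 0 <= x < pi -> partner x <= pi.
Proof.
move=> /andP[]; rewrite le_eqVlt => /predU1P[<- _|x0 xpi]; first by rewrite partner0.
by rewrite -[leRHS]partner0 ltW// partner_decreasing//; have := pi_gt0 R; lrah.
Qed.

Lemma is_derive_partner x : - pi < x < pi -> is_derive x 1 partner (partner_slope x).
Proof.
move=> xpi; have c0 := lt0r_neq0 (cos_half_gt0 xpi).
have dt := is_derive_tan_half c0.
have dat := @is_derive1_comp _ atan _ x _ _ (is_derive1_atan _)
  (is_derive_mulr (tan (h / 2) ^- 2) dt).
have := @is_deriveD _ _ _ (cst pi) _ x 1 _ _ (is_derive_cst _ _ _)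
  (is_derive_mulr (- 2) dat).
move/is_derive_eq => H; rewrite (_ : partner = cst pi +
  (fun x => (atan \o (fun x => tan (x / 2) * tan (h / 2) ^- 2)) x * - 2)); last first.
  by apply/funext => y; rewrite /partner fctE/=; ring.
apply: H; rewrite add0r (cos2_tan2 c0) /partner_slope.
set y := tan (x / 2); set t := tan (h / 2).
have t0 : 0 < t by [].
have := sqr_ge0 y; have : 0 < t ^+ 4 by rewrite exprn_gt0.
by move=> p4 y2; field; rewrite !gt_eqF//; lra.
Qed.

Lemma continuous_partner x : - pi < x < pi -> {for x, continuous partner}.
Proof.
by move=> /is_derive_partner dx; apply/differentiable_continuous/derivable1_diffP.
Qed.

Lemma continuous_tan_half x : - pi < x < pi -> {for x, continuous (fun x => tan (x / 2))}.
Proof.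
move=> xpi; have c0 := lt0r_neq0 (cos_half_gt0 xpi).
have dt := is_derive_tan_half c0.
exact/differentiable_continuous/derivable1_diffP.
Qed.

Lemma continuous_partner_slope x : - pi < x < pi -> {for x, continuous partner_slope}.
Proof.
move=> xpi; have ct := continuous_tan_half xpi.
have ct2 : {for x, continuous (fun x => tan (x / 2) ^+ 2)} by apply: cvgM.
apply: cvgN; apply: cvgM.
  by apply: cvgM; [exact: cvg_cst|apply: cvgD => //; exact: cvg_cst].
apply: cvgV; first by rewrite gt_eqF// ltr_pwDl ?exprn_gt0 ?sqr_ge0.
by apply: cvgD => //; exact: cvg_cst.
Qed.

(** The pairing transports the kernel to its opposite, the slope being negative.
    In the half-angle tangents this is an identity of rational functions. *)
Lemma kern_partner x : 0 <= x < h -> kern (partner x) * partner_slope x = kern x.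
Proof.
move=> xh; have p0 := pi_gt0 R.
have ch : cos (h / 2) != 0 by rewrite gt_eqF// cos_half_gt0//; lrah.
have cx : cos (x / 2) != 0 by rewrite gt_eqF// cos_half_gt0//; lrah.
set y := tan (x / 2); set t := tan (h / 2).
have t0 : 0 < t by [].
have y0 : 0 <= y.
  rewrite divr_ge0//; first by rewrite sin_ge0_pi//; lrah.
  by rewrite ltW// cos_half_gt0//; lrah.
have yt : y < t by rewrite /y /t ltr_tan ?in_tan//; lrah.
have cp : cos (partner x) = ((y / t ^+ 2) ^+ 2 - 1) / (1 + (y / t ^+ 2) ^+ 2).
  rewrite /partner -/y -/t; set a := atan _.
  rewrite cosB cospi sinpi mul0r addr0 mulN1r cos_tan_half.
    by rewrite mulrAC divff// mul1r /a atanK -mulNr opprB.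
  have -> : 2 * a / 2 = a by field.
  by rewrite gt_eqF// /a cos_atan invr_gt0 sqrtr_gt0 ltr_pwDl ?sqr_ge0.
rewrite /kern cp (cos_tan_half cx) (cos_tan_half ch) (sin_tan_half ch) /partner_slope -/y -/t.
have y2 := sqr_ge0 y; have t2 := sqr_ge0 t.
have yt2 : y ^+ 2 < t ^+ 2 by rewrite ltr_pXn2r// ?nnegrE// ltW.
have p4 : 0 < t ^+ 4 by rewrite exprn_gt0.
field.
have d1 : (1 - y ^+ 2) * (1 + t ^+ 2) + - (1 - t ^+ 2) * (1 + y ^+ 2) =
          2 * (t ^+ 2 - y ^+ 2) by ring.
have d2 : (y ^+ 2 + - 1 * t ^+ 4) * (1 + t ^+ 2) +
          - (1 - t ^+ 2) * (t ^+ 2 ^+ 2 + y ^+ 2) =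
          2 * t ^+ 2 * (y ^+ 2 - t ^+ 2) by ring.
rewrite {}d1 {}d2; apply/and5P; split.
- by rewrite gt_eqF//; lra.
- by rewrite gt_eqF//; lra.
- by rewrite gt_eqF// mulr_gt0// subr_gt0.
- by rewrite gt_eqF//; lra.
- rewrite gt_eqF//=.
  by rewrite lt_eqF// pmulr_rlt0 ?subr_lt0// mulr_gt0 ?exprn_gt0.
Qed.

Lemma continuous_kern u : cos u != cos h -> {for u, continuous kern}.
Proof.
move=> uh; apply: cvgM; first exact: cvg_cst.
apply: cvgV; first by rewrite subr_eq0.
by apply: cvgB; [exact: continuous_cos|exact: cvg_cst].
Qed.

Lemma continuous_kern_left u : 0 <= u < h -> {for u, continuous kern}.
Proof.
by move=> uh; apply: continuous_kern; rewrite gt_eqF// ltr_cos ?in_itv/=; lrah.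
Qed.

Lemma continuous_kern_right u : h < u <= pi -> {for u, continuous kern}.
Proof.
by move=> uh; apply: continuous_kern; rewrite lt_eqF// ltr_cos ?in_itv/=; lrah.
Qed.

Lemma kern_ge0 u : 0 <= u < h -> 0 <= kern u.
Proof.
move=> uh; rewrite divr_ge0//; first by rewrite sin_ge0_pi//; lrah.
by rewrite subr_ge0 ltW// ltr_cos ?in_itv/=; lrah.
Qed.

(** Negativity, bounded away from zero; this is what separates two candidate values
    of [rho]. *)
Lemma kern_right_le u : h < u <= pi -> kern u <= - (sin h / 2).
Proof.
move=> uh; have sh : 0 < sin h by exact: sin_gt0_pi.
have chu : cos u < cos h by rewrite ltr_cos ?in_itv/=; lrah.
rewrite /kern -mulrN ler_pM2l// -[leLHS]opprK lerN2 -invrN opprB.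
rewrite lef_pV2 ?posrE//; last lrah.
by have := cos_le1 h; have := cos_geN1 u; lrah.
Qed.

(** Change of variable along the pairing: the weighted negative mass beyond
    [partner x] equals the positive mass before [x]. *)
Lemma Int_partner (g : R -> R) x : continuous g -> 0 <= x < h ->
  Int (partner x) pi (fun u => g u * kern u) = - Int 0 x (fun u => g (partner u) * kern u).
Proof.
move=> cg xh; have x0 : 0 <= x by case/andP: xh.
have dF u : 0 <= u <= x -> is_derive u 1 partner (partner_slope u).
  by move=> ?; apply: is_derive_partner; lrah.
rewrite -{1}partner0 (Int_subst_decreasing x0 dF).
- rewrite -IntN.
    by apply: eq_Int => u ux; rewrite -(@kern_partner u); [ring|lrah].
  move=> u ux; apply: cvgM; last by apply: continuous_kern_left; lrah.
  by apply: continuous_comp; [apply: continuous_partner; lrah|exact: cg].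
- by move=> u ux; apply: continuous_partner_slope; lrah.
- by move=> u v; rewrite !in_itv/= => ? ? ?; apply: partner_decreasing; lrah.
- rewrite partner0 => u ux; apply: cvgM; first exact: cg.
  by apply: continuous_kern_right; have := partner_gt xh; lrah.
Qed.

End fixed_h.
End pairing.

(** * The function rho of the theorem and the reduction to one kernel *)

Section principal_value.
Context {R : realType}.
Implicit Types (g : R -> R) (x u h r t : R).

(** The change of variable [Int_partner] for a constant function. *)
Lemma rho_spec_partner t x : 0 < t < 2 * pi -> 0 < x < t / 2 ->
  rho_spec t x (partner (t / 2) x).
Proof.
move=> t0 x0; have p0 := pi_gt0 R; have hpi : 0 < t / 2 < pi by lra.
split.
  rewrite partner_gt//=; last lra.
  by rewrite -[ltRHS](partner0 (t / 2)) partner_decreasing//; lra.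
have := @Int_partner R _ hpi (cst 1) x (@cst_continuous _ _ _) ltac:(lra).
rewrite /diff_kernel -/(kern (t / 2)) => H.
rewrite -[LHS]opprK; congr (- _).
rewrite (@eq_Int _ (partner (t / 2) x) pi _ (fun u => cst 1 u * kern (t / 2) u)).
  by rewrite H; congr (- _); apply: eq_Int => u _; rewrite mul1r.
by move=> u _; rewrite mul1r.
Qed.

(** Between two solutions the integral of the negative kernel would vanish. *)
Lemma rho_spec_unique t x r1 r2 : 0 < t < 2 * pi ->
  rho_spec t x r1 -> rho_spec t x r2 -> r1 = r2.
Proof.
move=> t0; have p0 := pi_gt0 R; have hpi : 0 < t / 2 < pi by lra.
wlog r12 : r1 r2 / r1 < r2.
  by move=> H h1 h2; have [r12|r21|//] := ltgtP r1 r2; [|apply/esym]; exact: H.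
move=> [r1P e1] [r2P e2]; exfalso.
have ck : continuous_on r1 pi (kern (t / 2)).
  by move=> u ?; apply: continuous_kern_right => //; lra.
have := @Int_cat R r1 r2 pi _ (ltW r12) ltac:(lra) ck.
have : Int r1 r2 (kern (t / 2)) <= Int r1 r2 (fun=> - (sin (t / 2) / 2)).
  apply: le_Int.
  - by apply: continuous_onS ck; lra.
  - by move=> u _; exact: cvg_cst.
  - by move=> u ?; apply: kern_right_le => //; lra.
rewrite Int_cst; last exact: ltW.
have : 0 < sin (t / 2) * (r2 - r1).
  by rewrite mulr_gt0 ?subr_gt0// sin_gt0_pi.
move: e1 e2; rewrite /diff_kernel -!/(kern (t / 2)).
move: (Int 0 x _) (Int r1 pi _) (Int r2 pi _) (Int r1 r2 _) => A B C D.
lra.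
Qed.

(** Difference of two cotangents: with [A] and [B] the half angles, both sides
    equal [sin (B - A) / (2 sin A sin B)]. *)
Lemma half_cotB u h : sin ((u - h) / 2) != 0 -> sin ((u + h) / 2) != 0 ->
  half_cot (u - h) - half_cot (u + h) = - kern h u.
Proof.
rewrite /half_cot /kern; set A := (u - h) / 2; set B := (u + h) / 2 => A0 B0.
have -> : h = B - A by rewrite /A /B; field.
have -> : u = A + B by rewrite /A /B; field.
rewrite sinB cosD cosB; field.
rewrite A0 B0 andbT /=.
have -> : cos A * cos B - sin A * sin B - (cos B * cos A + sin B * sin A) =
  - (2 * sin A * sin B) by ring.
by rewrite oppr_eq0 !mulf_neq0.
Qed.

Lemma continuous_on_bounded a b (f : R -> R) : continuous_on a b f ->
  exists2 M : R, 0 <= M & forall x, a <= x <= b -> `|f x| <= M.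
Proof.
move=> cf; have [ab|ba] := leP a b; last by exists 0 => // x; lra.
have [c _ cP] := @EVT_max _ (fun x => `|f x|) a b ab
  (continuous_on_within (fun x xab => cvg_norm (cf x xab))).
by exists `|f c| => // x xab; apply: cP; rewrite in_itv.
Qed.

Section fixed_h.
Variable h : R.
Hypothesis h0pi : 0 < h < pi.

Local Ltac lrah := move: h0pi (pi_gt0 R) => *; lra.

Lemma sin_half_neq0 u : 0 < u < 2 * pi -> sin (u / 2) != 0.
Proof. by move=> u0; rewrite gt_eqF// sin_half_gt0. Qed.

Lemma continuous_half_cot_sum g : continuous g ->
  continuous_on 0 pi (fun u => g u * half_cot (u + h)).
Proof.
move=> cg u u0; apply: cvgM; first exact: cg.
apply: (@continuous_comp _ _ _ (fun u => u + h) half_cot).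
  by apply: cvgD; [exact: cvg_id|exact: cvg_cst].
by apply: half_cot_continuous; lrah.
Qed.

Lemma continuous_mul_kern_left g (a b : R) : continuous g -> 0 <= a -> b < h ->
  continuous_on a b (fun u => g u * kern h u).
Proof.
move=> cg a0 bh u uab; apply: cvgM; first exact: cg.
by apply: continuous_kern_left => //; lra.
Qed.

Lemma continuous_mul_kern_right g (a b : R) : continuous g -> h < a -> b <= pi ->
  continuous_on a b (fun u => g u * kern h u).
Proof.
move=> cg a0 bh u uab; apply: cvgM; first exact: cg.
by apply: continuous_kern_right => //; lra.
Qed.

(** The variable [h + s] runs over [h + d, pi] and over [pi, h + pi], which
    evenness and periodicity reflect onto [pi - h, pi]; likewise for [h - s].
    Collecting the pieces leaves the difference kernel outside the window
    of radius [d] around [h], and inside it only the nonsingular one of the two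
    cotangents that make up the kernel. *)
Lemma sym_diff_kern g (d : R) : continuous g -> periodic g (pi *+ 2) ->
  (forall u, g (- u) = g u) -> 0 < d -> d <= h -> d <= pi - h ->
  Int d pi (sym_diff g h) =
    - Int 0 (h - d) (fun u => g u * kern h u)
    - Int (h + d) pi (fun u => g u * kern h u)
    - Int (h - d) (h + d) (fun u => g u * half_cot (u + h)).
Proof.
move=> cg pg eg d0 dh dpi; have p0 := pi_gt0 R.
have hd0 : 0 <= h - d by lra.
have hdd : h - d <= h + d by lra.
have hdpi : h + d <= pi by lra.
have hd_pi : h - d <= pi by lra.
have ph0 : 0 <= pi - h by lrah.
have phpi : pi - h <= pi by lrah.
pose F u := g u * half_cot (u - h).
pose G u := g u * half_cot (h - u).
pose M u := g u * half_cot (u + h).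
have cF : continuous_on (h + d) (h + pi) F.
  move=> u ?; apply: cvgM; first exact: cg.
  apply: (@continuous_comp _ _ _ (fun u => u - h) half_cot).
    by apply: cvgB; [exact: cvg_id|exact: cvg_cst].
  by apply: half_cot_continuous; lrah.
have cG : continuous_on (h - pi) (h - d) G.
  move=> u ?; apply: cvgM; first exact: cg.
  apply: (@continuous_comp _ _ _ (fun u => h - u) half_cot).
    by apply: cvgB; [exact: cvg_cst|exact: cvg_id].
  by apply: half_cot_continuous; lrah.
have cM := continuous_half_cot_sum cg; rewrite -/M in cM.
have shiftE : Int d pi (fun s => g (h + s) * half_cot s) =
    Int (h + d) pi F - Int (pi - h) pi M.
  transitivity (Int d pi (fun s => F (h + s))).
    by apply: eq_Int => s _; rewrite /F addrAC subrr add0r.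
  rewrite (Int_shift _ cF); last lrah.
  rewrite (@Int_cat R (h + d) pi (h + pi))//; last lrah.
  congr (_ + _).
  rewrite (@Int_reflectE R (2 * pi) (pi - h) pi); [|lrah|lrah|lrah|]; last first.
    by apply: continuous_onS cF; lrah.
  rewrite -IntN; last by apply: continuous_onS cM; lrah.
  apply: eq_Int => u _; rewrite /F /M.
  rewrite (_ : 2 * pi - u - h = 2 * pi - (u + h)); last by ring.
  rewrite half_cot2piB (_ : 2 * pi - u = - u + pi *+ 2); last by ring.
  by rewrite pg eg mulrN.
have reflE : Int d pi (fun s => g (h - s) * half_cot s) =
    Int 0 (pi - h) M + Int 0 (h - d) G.
  transitivity (Int d pi (fun s => G (h - s))).
    by apply: eq_Int => s _; rewrite /G subKr.
  rewrite (Int_reflect _ cG); last lrah.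
  rewrite (@Int_cat R (h - pi) 0 (h - d))//; last lrah.
  congr (_ + _).
  rewrite (@Int_reflectE R 0 0 (pi - h)); [|lrah|lrah|lrah|]; last first.
    by apply: continuous_onS cG; lrah.
  by apply: eq_Int => u _; rewrite /G /M sub0r opprK eg (addrC h).
have cl := @continuous_mul_kern_left g 0 (h - d) cg (lexx _) ltac:(lra).
have cr := @continuous_mul_kern_right g (h + d) pi cg ltac:(lra) (lexx _).
have leftE : Int 0 (h - d) (fun u => g u * kern h u) = Int 0 (h - d) G + Int 0 (h - d) M.
  rewrite -IntD; last 2 first.
  - by apply: continuous_onS cG; lrah.
  - by apply: continuous_onS cM; lrah.
  apply: eq_Int => u u0; rewrite /G /M -[kern h u]opprK -half_cotB.
  - by rewrite -(opprB u h) half_cotN; ring.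
  - rewrite -(opprB h u) mulNr sinN oppr_eq0; apply: sin_half_neq0; lrah.
  - by apply: sin_half_neq0; lrah.
have rightE : Int (h + d) pi (fun u => g u * kern h u) =
    Int (h + d) pi M - Int (h + d) pi F.
  rewrite -IntB; last 2 first.
  - by apply: continuous_onS cM; lrah.
  - by apply: continuous_onS cF; lrah.
  apply: eq_Int => u u0; rewrite /F /M -[kern h u]opprK -half_cotB.
  - by ring.
  - by apply: sin_half_neq0; lrah.
  - by apply: sin_half_neq0; lrah.
have M1 := @Int_cat R 0 (pi - h) pi M ph0 phpi cM.
have M2 := @Int_cat R 0 (h - d) pi M hd0 hd_pi cM.
have M3 := @Int_cat R (h - d) (h + d) pi M hdd hdpi (continuous_onS hd0 (lexx pi) cM).
rewrite leftE rightE /sym_diff.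
rewrite (@eq_Int _ d pi _
  (fun s => g (h + s) * half_cot s - g (h - s) * half_cot s)); last first.
  by move=> s _; rewrite mulrBl.
rewrite IntB; last 2 first.
- apply: continuous_onM; last exact: continuous_half_cot.
  by apply: continuous_onT; exact: continuous_translate.
- apply: continuous_onM; last exact: continuous_half_cot.
  by apply: continuous_onT; exact: continuous_reflect.
rewrite shiftE reflE.
lra.
Qed.

End fixed_h.
End principal_value.

(** * Cancellation of the principal value by the pairing *)

Section principal_value.
Context {R : realType}.
Implicit Types (g : R -> R) (x u h r t : R).

Section fixed_h.
Variable h : R.
Hypothesis h0pi : 0 < h < pi.

Local Ltac lrah := move: h0pi (pi_gt0 R) => *; lra.

(** The kernel has constant sign beyond [h], so its integral against [g] is
    controlled by its own integral. *)
Let normr_Int_kern_right g (M a b : R) : continuous g ->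
  (forall u, 0 <= u <= pi -> `|g u| <= M) -> h < a -> a <= b -> b <= pi ->
  `|Int a pi (fun u => g u * kern h u) - Int b pi (fun u => g u * kern h u)| <=
  M * `|Int a pi (kern h) - Int b pi (kern h)|.
Proof.
move=> cg gM ha ab bpi.
have ck : continuous_on a pi (kern h).
  by move=> u ?; apply: continuous_kern_right => //; lra.
have cgk := continuous_mul_kern_right h0pi cg ha (lexx pi).
rewrite (Int_cat ab bpi cgk) (Int_cat ab bpi ck) !addrK.
have k0 u : a <= u <= b -> kern h u <= 0.
  move=> ?; apply: le_trans (kern_right_le h0pi _) _; first lra.
  by rewrite oppr_le0 divr_ge0// ltW// sin_gt0_pi.
have ckab : continuous_on a b (kern h) by apply: continuous_onS ck => //.
rewrite [X in M * X]ler0_norm; last first.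
  rewrite -oppr_ge0 -IntN//; apply: Int_ge0 => u /k0.
  by rewrite oppr_ge0.
rewrite mulrN -mulNr -IntZ//; apply: normr_Int_le.
- by apply: continuous_onS cgk => //.
- by apply: continuous_onM => //; apply: continuous_onT; exact: cst_continuous.
- move=> u uab; have ku := k0 u uab.
  by rewrite normrM (ler0_norm ku) mulNr -mulrN ler_wpM2r ?oppr_ge0// gM//; lrah.
Qed.

(** The pairing cuts the singularity at [h - d] and [partner (h - d)], the
    principal value at [h - d] and [h + d].  Applying [sym_diff_kern] to a
    constant, whose symmetric differences vanish, shows that the kernel has
    integral O(d) between [partner (h - d)] and [h + d]; hence so has its
    product with [g]. *)
Lemma cvg_pairing g : continuous g -> periodic g (pi *+ 2) ->
  (forall u, g (- u) = g u) ->
  Int 0 (h - d) (fun u => (g u - g (partner h u)) * kern h u) +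
    Int d pi (sym_diff g h) @[d --> 0^'+] --> 0.
Proof.
move=> cg pg eg; have p0 := pi_gt0 R.
pose one (u : R) : R := 1.
have c1 : continuous one by move=> u; exact: cvg_cst.
have [M M0 gM] := continuous_on_bounded (continuous_onT (a := 0) (b := pi) cg).
have [B B0 BP] := continuous_on_bounded (continuous_half_cot_sum h0pi cg).
have [C C0 CP] := continuous_on_bounded (continuous_half_cot_sum h0pi c1).
apply/cvgrPdist_le => e e0.
have h1 : 0 < e / (2 * (B + M * C) + 1).
  by rewrite divr_gt0// ltr_wpDl// mulr_ge0// addr_ge0// mulr_ge0.
near=> d.
have d0 : 0 < d by near: d; exact: nbhs_right_gt.
have dh : d < h by near: d; apply: nbhs_right_lt; lrah.
have dpi : d < pi - h by near: d; apply: nbhs_right_lt; lrah.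
have de : d <= e / (2 * (B + M * C) + 1) by near: d; exact: nbhs_right_le.
have bound (f : R -> R) (D : R) : continuous f ->
    (forall u, 0 <= u <= pi -> `|f u * half_cot (u + h)| <= D) ->
    `|Int (h - d) (h + d) (fun u => f u * half_cot (u + h))| <= D * (2 * d).
  move=> cf fD; rewrite (_ : 2 * d = h + d - (h - d)); last by ring.
  apply: normr_Int_le_cst.
  - by lrah.
  - by apply: continuous_onS (continuous_half_cot_sum h0pi cf); lrah.
  - by move=> u ?; apply: fD; lrah.
have x0 : 0 <= h - d < h by lrah.
have E1 := sym_diff_kern h0pi cg pg eg d0 (ltW dh) (ltW dpi).
have E2 := @sym_diff_kern _ h h0pi one d c1 (fun=> erefl) (fun=> erefl)
  d0 (ltW dh) (ltW dpi).
have P1 := Int_partner h0pi cg x0.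
(* the constant function 1 measures the asymmetry of the two cuts *)
have P2 := Int_partner h0pi c1 x0.
have S0 : Int d pi (sym_diff one h) = 0.
  rewrite (@eq_Int _ d pi _ (fun=> 0)); last first.
    by move=> s _; rewrite /sym_diff subrr mul0r.
  by rewrite Int_cst ?mul0r//; lra.
have one1 a b : Int a b (fun u => one u * kern h u) = Int a b (kern h).
  by apply: eq_Int => u _; rewrite mul1r.
rewrite !one1 in E2 P2.
rewrite S0 {S0} in E2.
have diffE : Int 0 (h - d) (fun u => (g u - g (partner h u)) * kern h u) =
    Int 0 (h - d) (fun u => g u * kern h u) -
    Int 0 (h - d) (fun u => g (partner h u) * kern h u).
  rewrite -IntB.
  - by apply: eq_Int => u _; rewrite mulrBl.
  - by apply: continuous_mul_kern_left => //; lra.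
  - apply: continuous_onM; last by move=> u ?; apply: continuous_kern_left => //; lra.
    move=> u ?; apply: (@continuous_comp _ _ _ (partner h) g); last exact: cg.
    by apply: continuous_partner => //; lrah.
have Mk : `|Int (partner h (h - d)) pi (fun u => g u * kern h u) -
            Int (h + d) pi (fun u => g u * kern h u)| <=
    M * `|Int (partner h (h - d)) pi (kern h) - Int (h + d) pi (kern h)|.
  have hp := partner_gt h0pi x0; have pp := @partner_le _ _ h0pi (h - d) ltac:(lrah).
  have [ab|ba] := leP (partner h (h - d)) (h + d).
    by apply: normr_Int_kern_right => //; lrah.
  rewrite distrC [X in M * X]distrC.
  by apply: normr_Int_kern_right => //; [lrah|exact: ltW].
have b1 := bound g B cg BP.
have b2 := bound one C c1 CP.
rewrite sub0r normrN diffE E1.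
have Mk2 : M * `|Int (partner h (h - d)) pi (kern h) - Int (h + d) pi (kern h)| <=
    M * (C * (2 * d)).
  rewrite ler_wpM2l//; apply: le_trans b2.
  by rewrite le_eqVlt; apply/orP; left; apply/eqP; congr (`|_|); lra.
move: Mk b1; rewrite ler_pdivlMr in de; last first.
  by rewrite ltr_wpDl// mulr_ge0// addr_ge0// mulr_ge0.
rewrite !ler_norml; lra.
Unshelve. all: by end_near. Qed.

End fixed_h.
End principal_value.

(** * Concave moduli as limits of sums of truncations *)

Section concave_approximation.
Context {R : realType}.
Variable omega : R -> R.
Hypothesis omega_modulus : modulus_of_continuity omega.
Hypothesis omega_concave : concave_on `[0, +oo[ omega.
Implicit Types (s c u v : R).

Lemma concave_chord (a b t : R) : 0 <= a -> 0 <= b -> 0 <= t <= 1 ->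
  t * omega a + (1 - t) * omega b <= omega (t * a + (1 - t) * b).
Proof.
move=> a0 b0 /andP[t0 t1].
have := @omega_concave (Itv01 t0 t1) a b.
rewrite !inE/= !in_itv/= !andbT a0 b0 => /(_ isT isT).
rewrite !convRE/= /unstable.onem; lra.
Qed.

(** The interpolation of [omega] at the multiples of [eta], constant beyond the
    last node, is a nonnegative combination of truncations [Num.min s c], because
    its slopes decrease to 0.  The class of such combinations enters only through
    the closure properties of [P], which the layered functions will satisfy. *)
Lemma concave_min_approximation (P : (R -> R) -> Prop) (C eta : R) :
  P (fun=> 0) ->
  (forall (v : R -> R) a c, P v -> 0 <= a -> 0 <= c <= C ->
    P (fun s => v s + a * Num.min s c)) ->
  0 < eta -> forall n, n.+1%:R * eta <= C ->
  exists w, [/\ P w, forall s, 0 <= s -> w s <= omega s &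
    forall s, 0 <= s <= n.+1%:R * eta -> omega s - omega eta <= w s].
Proof.
move=> P0 Padd e0.
pose p (i : nat) := omega (i%:R * eta).
pose slope n := (p n.+1 - p n) / eta.
have pE n : p n.+1 = omega (n%:R * eta + eta) by rewrite /p -natr1 mulrDl mul1r.
have slope0 n : 0 <= slope n.
  rewrite divr_ge0 ?(ltW e0)// subr_ge0 (modulus_le omega_modulus)//.
    by rewrite mulr_ge0 ?(ltW e0).
  by rewrite ler_pM2r// ler_nat.
have slope_decr n : slope n.+1 <= slope n.
  rewrite ler_pM2r ?invr_gt0//.
  have := @concave_chord (n.+2%:R * eta) (n%:R * eta) 2^-1.
  have half01 : 0 <= (2^-1 : R) <= 1 by lra.
  rewrite !mulr_ge0 ?(ltW e0)// => /(_ isT isT half01).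
  rewrite (_ : 2^-1 * (n.+2%:R * eta) + _ = n.+1%:R * eta).
    by rewrite -/(p n.+2) -/(p n.+1) -/(p n); lra.
  by rewrite -(natr1 n.+1) -(natr1 n); field.
have chord n s : n%:R * eta <= s <= n.+1%:R * eta ->
    p n + slope n * (s - n%:R * eta) <= omega s.
  move=> sn; have n0 : 0 <= n%:R * eta by rewrite mulr_ge0 ?(ltW e0).
  (* barycentric coordinate of s between two consecutive nodes *)
  pose t := (s - n%:R * eta) / eta.
  have sE : s = t * (n.+1%:R * eta) + (1 - t) * (n%:R * eta).
    by rewrite /t -natr1; field; rewrite gt_eqF.
  have t01 : 0 <= t <= 1.
    rewrite /t ler_pdivlMr// mul0r ler_pdivrMr// mul1r.
    by move: sn; rewrite -natr1 mulrDl mul1r; lra.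
  have := @concave_chord (n.+1%:R * eta) (n%:R * eta) t ltac:(lra) n0 t01.
  rewrite -sE -/(p n) -/(p n.+1); apply: le_trans.
  by rewrite /slope /t le_eqVlt; apply/orP; left; apply/eqP; field; rewrite gt_eqF.
have drop n s : n%:R * eta <= s <= n.+1%:R * eta -> omega s - omega eta <= p n.
  move=> sn; have n0 : 0 <= n%:R * eta by rewrite mulr_ge0 ?(ltW e0).
  rewrite lerBlDr -(subrK (n%:R * eta) s) addrC.
  apply: le_trans (modulusD omega_modulus _ _) _ => //; first lra.
  rewrite lerD2l (modulus_le omega_modulus)//; first lra.
  by move: sn; rewrite -natr1 mulrDl mul1r; lra.
have le_tail n s : n%:R * eta <= s -> p n <= omega s.
  by move=> ns; apply: modulus_le => //; rewrite mulr_ge0 ?(ltW e0).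
have slopeE n : slope n * (n.+1%:R * eta - n%:R * eta) = p n.+1 - p n.
  by rewrite -(natr1 n) mulrDl mul1r addrAC subrr add0r divfK ?gt_eqF.
have p00 : p 0 = 0 by rewrite /p mul0r (modulus0 omega_modulus).
suff main n : n.+1%:R * eta <= C -> exists2 v, P v &
    [/\ forall s, 0 <= s -> v s + slope n * Num.min s (n.+1%:R * eta) <= omega s,
        forall s, n.+1%:R * eta <= s -> v s + slope n * (n.+1%:R * eta) = p n.+1 &
        forall s, 0 <= s <= n.+1%:R * eta ->
          omega s - omega eta <= v s + slope n * s].
  move=> n nC; have [v Pv [v1 v2 v3]] := main n nC.
  exists (fun s => v s + slope n * Num.min s (n.+1%:R * eta)); split => //.
    by apply: Padd => //; rewrite nC andbT mulr_ge0 ?(ltW e0).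
  by move=> s sn; have /andP[_ /min_idPl ->] := sn; exact: v3.
elim: n => [|n IH] nC.
  have sE := slopeE 0; rewrite p00 mul0r !subr0 in sE.
  exists (fun=> 0) => //; split => [s s0|s es|s s0].
  - rewrite add0r; have [sn|ns] := leP s (1 * eta).
      by have := chord 0 s; rewrite mul0r subr0 s0 p00 add0r; apply.
    by rewrite sE; apply: le_tail; exact: ltW.
  - by rewrite add0r.
  - rewrite add0r; apply: le_trans (drop 0 s _) _; first by rewrite mul0r.
    by rewrite p00 mulr_ge0//; case/andP: s0.
have mC : n.+1%:R * eta <= C.
  by apply: le_trans nC; rewrite ler_pM2r// ler_nat.
have [v Pv [v1 v2 v3]] := IH mC.
have sE := slopeE n.+1; have ch := chord n.+1; have dr := drop n.+1.
have lt2 := le_tail n.+2; have sl0 := slope0 n.+1; have sld := slope_decr n.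
have m0 : 0 <= n.+1%:R * eta by rewrite mulr_ge0 ?(ltW e0).
have mM : n.+1%:R * eta <= n.+2%:R * eta by rewrite ler_pM2r// ler_nat.
have nn : p n.+1 - p n.+1 = 0 by rewrite subrr.
set m := n.+1%:R * eta in v1 v2 v3 sE ch dr m0 mM mC *.
set M := n.+2%:R * eta in sE ch dr lt2 mM *.
(* moving the last node turns part of the final slope into a new truncation *)
exists (fun s => v s + (slope n - slope n.+1) * Num.min s m).
  by apply: Padd => //; [rewrite subr_ge0|rewrite m0].
split => [s s0|s Ms|s /andP[s0 sM]].
- have [sm|ms] := leP s m.
    have := v1 s s0; rewrite (min_idPl sm).
    by rewrite (min_idPl (le_trans sm mM)); lra.
  have := v2 s (ltW ms); have [sM|Ms] := leP s M.
    by have := ch s; rewrite (ltW ms) sM => /(_ isT); lra.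
  by have := lt2 s (ltW Ms); lra.
- have ms := le_trans mM Ms.
  by have := v2 s ms; rewrite (min_idPr ms); lra.
- have [sm|ms] := leP s m.
    by have := v3 s; rewrite s0 sm => /(_ isT); lra.
  have := v2 s (ltW ms); have := dr s; rewrite (ltW ms) sM => /(_ isT).
  have : 0 <= slope n.+1 * (s - m) by rewrite mulr_ge0// subr_ge0 ltW.
  lra.
Qed.
End concave_approximation.

(** * Extremal functions built from nested layers *)

Section folding.
Context {R : realType}.
Implicit Types x y u : R.

(** The distance to the nearest multiple of [2 * pi]. *)
Definition fold_angle x := acos (cos x).

Let cos_itv x : -1 <= cos x <= 1.
Proof. by rewrite cos_geN1 cos_le1. Qed.

Lemma fold_angle_itv x : 0 <= fold_angle x <= pi.
Proof. by rewrite acos_ge0 ?cos_itv ?acos_lepi. Qed.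

Lemma cos_fold x : cos (fold_angle x) = cos x.
Proof. by rewrite acosK// in_itv/= cos_itv. Qed.

Lemma sin_fold x : sin (fold_angle x) = `|sin x|.
Proof.
apply/eqP; rewrite -(@eqrXn2 _ 2)// ?sin_ge0_pi ?fold_angle_itv//.
by rewrite real_normK ?num_real// !sin2cos2 cos_fold.
Qed.

Lemma fold_angle_id u : 0 <= u <= pi -> fold_angle u = u.
Proof. by move=> u0; rewrite /fold_angle cosK// in_itv. Qed.

Lemma fold_angleN x : fold_angle (- x) = fold_angle x.
Proof. by rewrite /fold_angle cosN. Qed.

Lemma fold_angle_periodic : periodic fold_angle (pi *+ 2).
Proof. by move=> x; rewrite /fold_angle cosD2pi. Qed.

(** Folding keeps the product of the cosines and replaces that of the sines by
    its absolute value, so the cosine of the difference can only increase. *)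
Lemma fold_angle_dist x y : `|fold_angle x - fold_angle y| <= `|x - y|.
Proof.
have [xypi|xypi] := leP `|x - y| pi; last first.
  apply: le_trans (ltW xypi); have := fold_angle_itv x; have := fold_angle_itv y.
  by rewrite ler_norml; lra.
have fpi : `|fold_angle x - fold_angle y| <= pi.
  by have := fold_angle_itv x; have := fold_angle_itv y; rewrite ler_norml; lra.
have : cos `|x - y| <= cos `|fold_angle x - fold_angle y|.
  rewrite !cos_norm !cosB !cos_fold !sin_fold lerD2l -normrM; exact: ler_norm.
apply: contraTT; rewrite -!ltNge => lt.
by rewrite ltr_cos ?in_itv/= ?normr_ge0.
Qed.

End folding.

Section layers.
Context {R : realType}.
Implicit Types a b c u v x : R.

(** The projection of [u] onto [a, b]; minus it decreases with slope 1 on [a, b]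
    and is constant elsewhere. *)
Definition layer a b u := Num.min b (Num.max a u).

Lemma layer_sub a b u v : a <= b -> u <= v ->
  0 <= layer a b v - layer a b u <= Num.min (v - u) (b - a).
Proof.
move=> ab uv; rewrite /layer le_min.
have [au|au] := leP a u; have [av|av] := leP a v;
  repeat match goal with |- context [Num.min ?p ?q] => have [?|?] := leP p q end; lra.
Qed.

Lemma layer_sub_in a b u v : a <= u -> u <= v -> v <= b ->
  layer a b v - layer a b u = v - u.
Proof.
move=> au uv vb; rewrite /layer !(max_idPr _) ?(le_trans au)//.
by rewrite !(min_idPr _) ?(le_trans uv).
Qed.

Lemma layer_sub_out a b u v : u <= a -> a <= b -> b <= v ->
  layer a b v - layer a b u = b - a.
Proof.
move=> ua ab bv; rewrite /layer (max_idPl ua) (max_idPr (le_trans ab bv)).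
by rewrite (min_idPl bv) (min_idPr ab).
Qed.

Section fixed_h.
Variable h : R.
Hypothesis h0pi : 0 < h < pi.

Local Ltac lrah := move: h0pi (pi_gt0 R) => *; lra.

Lemma partner_gap_surj c : 0 <= c <= pi ->
  exists2 x, 0 <= x <= h & partner h x - x = c.
Proof.
move=> c0.
have cf : {within `[0, h], continuous (fun x => partner h x - x)}.
  apply: continuous_on_within => x x0; apply: cvgB; last exact: cvg_id.
  by apply: continuous_partner => //; lrah.
have [||x] := @IVT _ (fun x => partner h x - x) 0 h c _ cf.
- by lrah.
- rewrite partner0 (partner_h h0pi) subr0 subrr.
  by rewrite (min_idPr (pi_ge0 R)) (max_idPl (pi_ge0 R)).
- by rewrite in_itv/= => x0 <-; exists x.
Qed.

(** [w] is realized by a single nonincreasing potential on all the nested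
    intervals [u, partner u] simultaneously, and bounds its differences. *)
Definition layered (w : R -> R) := exists F : R -> R,
  (forall u v, u <= v -> 0 <= F u - F v <= w (v - u)) /\
  (forall u, 0 <= u < h -> F u - F (partner h u) = w (partner h u - u)).

Lemma layered0 : layered (fun=> 0).
Proof. by exists (fun=> 0); split => [u v _|u _]; rewrite subrr ?lexx. Qed.

(** Nestedness: [u, partner u] either contains the interval of length [c] or is
    contained in it, so it meets it in length [min (partner u - u) c]. *)
Lemma layeredD (w : R -> R) (a c : R) : layered w -> 0 <= a -> 0 <= c <= pi ->
  layered (fun s => w s + a * Num.min s c).
Proof.
move=> [F [F1 F2]] a0 /partner_gap_surj[x x0 xc].
have p0 : x <= partner h x.
  have [->|xh] := eqVneq x h; first by rewrite (partner_h h0pi).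
  by have := @partner_gt _ _ h0pi x; rewrite lt_neqAle xh; lrah.
exists (fun u => F u - a * layer x (partner h x) u); split => [u v uv|u u0].
  have := layer_sub p0 uv; rewrite xc => /andP[l1 l2].
  have /andP[F3 F4] := F1 u v uv.
  have := mulr_ge0 a0 l1; have := ler_wpM2l a0 l2; lra.
suff : layer x (partner h x) (partner h u) - layer x (partner h x) u = Num.min (partner h u - u) c.
  by have := F2 u u0 => + <-; lra.
have pu := partner_gt h0pi u0.
have [ux|xu] := leP u x.
  have pp : partner h x <= partner h u.
    move: ux; rewrite le_eqVlt => /predU1P[->//|ux].
    by rewrite ltW// partner_decreasing//; lrah.
  by rewrite layer_sub_out// xc (min_idPr _)//; lra.
have pp : partner h u <= partner h x by rewrite ltW// partner_decreasing//; lrah.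
by rewrite layer_sub_in ?(ltW xu)// ?(min_idPl _)//; lrah.
Qed.

Lemma extremal_function (omega w : R -> R) : modulus_of_continuity omega ->
  layered w -> (forall s, 0 <= s -> w s <= omega s) ->
  exists f, [/\ H_ omega f, forall u, f (- u) = f u &
    forall u, 0 <= u < h -> f u - f (partner h u) = w (partner h u - u)].
Proof.
move=> om [F [F1 F2]] wom; exists (F \o fold_angle); split.
- apply/(H_P om); split=> [x|x y] /=; first by rewrite fold_angle_periodic.
  have Fle u v : u <= v -> `|F u - F v| <= omega (v - u).
    move=> uv; have /andP[F3 F4] := F1 u v uv.
    by rewrite ger0_norm// (le_trans F4)// wom// subr_ge0.
  apply: le_trans (modulus_le om _ (fold_angle_dist x y)) => //.
  have [xy|yx] := leP (fold_angle x) (fold_angle y).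
    by rewrite (distrC (fold_angle x)) (ger0_norm (x := fold_angle y - fold_angle x)) ?subr_ge0// Fle.
  by rewrite distrC (ger0_norm (x := fold_angle x - fold_angle y)) ?subr_ge0 ?(ltW yx)// Fle// ltW.
- by move=> u /=; rewrite fold_angleN.
- move=> u u0 /=.
  have pu : 0 <= partner h u <= pi.
    by have := partner_gt h0pi u0; have := @partner_le _ _ h0pi u ltac:(lrah); lrah.
  by rewrite fold_angle_id ?fold_angle_id ?F2//; lrah.
Qed.

End fixed_h.
End layers.

(** * Suprema of the increments *)

Section increment.
Context {R : realType}.
Variable omega : R -> R.
Hypothesis omega_modulus : modulus_of_continuity omega.
Hypothesis omega_dini : exists2 eps : R, 0 < eps &
      (\int[lebesgue_measure]_(t in `]0%R, eps[) (omega t / t)%:E < +oo)%E.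
Implicit Types (f g : R -> R) (s t x y u c : R).

Lemma norm_lim_le (A : R -> R) (l : R) (I : \bar R) :
  A d @[d --> 0^'+] --> l ->
  (\forall d \near 0^'+, (`|A d|%:E <= I)%E) -> (`|l|%:E <= I)%E.
Proof.
move=> Al AI; apply: (closed_cvg [set y : R | (y%:E <= I)%E] _ AI _ (cvg_norm Al)).
case: I {AI} => [r| |].
- rewrite (_ : [set y | _] = [set y | y <= r]); first exact: closed_le.
  by apply/seteqP; split => y /=; rewrite lee_fin.
- rewrite (_ : [set y | _] = setT); first exact: closedT.
  by apply/seteqP; split => y //= _; rewrite leey.
- rewrite (_ : [set y | _] = set0); first exact: closed0.
  by apply/seteqP; split => y.
Qed.

(** The even part of [f] about the point [c]. *)
Definition symmetrization f c u := (f (c + u) + f (c - u)) / 2.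

Lemma symmetrization_even f c u : symmetrization f c (- u) = symmetrization f c u.
Proof. by rewrite /symmetrization opprK addrC. Qed.

Lemma H_symmetrization f c : H_ omega f -> H_ omega (symmetrization f c).
Proof.
move=> /(H_P omega_modulus)[pf fP]; apply/(H_P omega_modulus); split=> [u|x y].
  rewrite /symmetrization addrA pf; congr ((_ + _) / 2).
  by rewrite -(pf (c - _)); congr f; ring.
have h1 := fP (c + x) (c + y); have h2 := fP (c - x) (c - y).
rewrite /symmetrization -mulrBl normrM [X in _ * X]gtr0_norm// ler_pdivrMr//.
rewrite (_ : _ - _ = (f (c + x) - f (c + y)) + (f (c - x) - f (c - y))); last by ring.
apply: le_trans (ler_normD _ _) _; rewrite mulrDr !mulr1 lerD//.
  by rewrite (le_trans h1)// (_ : _ - _ = x - y)//; ring.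
by rewrite (le_trans h2)// distrC (_ : _ - _ = x - y)//; ring.
Qed.

Lemma conj_fun_symmetrization f c x : H_ omega f ->
  conj_fun f (c + x) - conj_fun f (c - x) = 2 * conj_fun (symmetrization f c) x.
Proof.
move=> Hf; have [_ gP] := (H_P omega_modulus _).1 (H_symmetrization c Hf).
have [_ fP] := (H_P omega_modulus _).1 Hf.
have p0 := pi_gt0 R; have cf := modulated_continuous omega_modulus fP.
have /mulfI : - pi != 0 :> R by rewrite oppr_eq0 gt_eqF.
apply; rewrite mulrCA (conj_fun_unique omega_modulus omega_dini (f := symmetrization f c)
  (l := (- pi * conj_fun f (c + x) - (- pi * conj_fun f (c - x))) / 2))//; first by field.
have H : (Int d pi (sym_diff f (c + x)) - Int d pi (sym_diff f (c - x))) / 2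
    @[d --> 0^'+] --> (- pi * conj_fun f (c + x) - (- pi * conj_fun f (c - x))) / 2.
  apply: cvgM; last exact: cvg_cst.
  by apply: cvgB; exact: (cvg_sym_diff omega_modulus omega_dini).
apply: cvg_trans H; apply: near_eq_cvg; near=> d.
have d0 : 0 < d by near: d; exact: nbhs_right_gt.
have cs z := @continuous_sym_diff R f z d pi cf d0 (lexx pi).
rewrite -IntB// mulrC -IntZ; last by move=> s ?; apply: cvgB; exact: cs.
apply: eq_Int => s _; rewrite /sym_diff /symmetrization.
rewrite !opprD !opprK !addrA; field.
Unshelve. all: by end_near. Qed.

Section fixed_h.
Variable h : R.
Hypothesis h0pi : 0 < h < pi.

Local Ltac lrah := move: h0pi (pi_gt0 R) => *; lra.

(** The principal value has become an ordinary improper integral: differences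
    along the pairing vanish at [h]. *)
Lemma cvg_conj_pairing g : H_ omega g -> (forall u, g (- u) = g u) ->
  Int 0 (h - d) (fun u => (g u - g (partner h u)) * kern h u) @[d --> 0^'+] -->
  pi * conj_fun g h.
Proof.
move=> /(H_P omega_modulus)[pg gP] eg; have cg := modulated_continuous omega_modulus gP.
have H : Int 0 (h - d) (fun u => (g u - g (partner h u)) * kern h u) +
    Int d pi (sym_diff g h) - Int d pi (sym_diff g h) @[d --> 0^'+] -->
    0 - (- pi * conj_fun g h).
  apply: cvgB; first exact: cvg_pairing.
  exact: (cvg_sym_diff omega_modulus omega_dini).
rewrite sub0r mulNr opprK in H; apply: cvg_trans H; apply: near_eq_cvg; near=> d.
by rewrite addrK.
Unshelve. all: by end_near. Qed.

(** On [0, h] the gap [partner h u - u] is nonnegative.  Since [omega] is continuous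
    within [0, +oo) only, it is composed with the absolute value. *)
Definition increment_density u := kern h u * omega `|partner h u - u|.

Lemma continuous_increment_density u : 0 <= u < h -> {for u, continuous increment_density}.
Proof.
move=> u0; apply: cvgM; first exact: continuous_kern_left.
apply: (@continuous_comp _ _ _ (fun u => partner h u - u) (fun s => omega `|s|)).
  by apply: cvgB; [apply: continuous_partner => //; lrah|exact: cvg_id].
exact: (continuous_modulus_norm omega_modulus).
Qed.

Lemma increment_density_ge0 u : 0 <= u < h -> 0 <= increment_density u.
Proof.
by move=> u0; rewrite mulr_ge0 ?kern_ge0 ?(modulus_ge0 omega_modulus).
Qed.

Lemma Int_increment_density_le (d : R) : d < h ->
  ((Int 0 d increment_density)%:E <=
   \int[mu]_(u in `]0%R, h[) (increment_density u)%:E)%E.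
Proof.
move=> dh; apply: Int_le_open_integral; rewrite ?(ltW dh)//.
- by move=> u ?; apply: continuous_increment_density; lra.
- by move=> u ?; apply: continuous_increment_density; lra.
- by move=> u ?; apply: increment_density_ge0; lra.
Qed.

Let continuous_pairing_diff g (d : R) : continuous g -> d < h ->
  continuous_on 0 d (fun u => (g u - g (partner h u)) * kern h u).
Proof.
move=> cg dh; apply: continuous_onM; last first.
  by move=> u ?; apply: continuous_kern_left => //; lra.
move=> u u0; apply: cvgB; first exact: cg.
apply: (@continuous_comp _ _ _ (partner h) g); last exact: cg.
by apply: continuous_partner => //; lrah.
Qed.

Lemma norm_conj_fun_even_le g : H_ omega g -> (forall u, g (- u) = g u) ->
  (`|pi * conj_fun g h|%:E <=
   \int[mu]_(u in `]0%R, h[) (increment_density u)%:E)%E.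
Proof.
move=> Hg eg; apply: (norm_lim_le (cvg_conj_pairing Hg eg)); near=> d.
have d0 : 0 < d by near: d; exact: nbhs_right_gt.
have dh : h - d < h by lra.
apply: le_trans (Int_increment_density_le dh); rewrite lee_fin.
have [_ gP] := (H_P omega_modulus _).1 Hg.
apply: normr_Int_le.
- by apply: continuous_pairing_diff; first exact: (modulated_continuous omega_modulus gP).
- by move=> u ?; apply: continuous_increment_density; lra.
- move=> u u0; have k0 : 0 <= kern h u by apply: kern_ge0 => //; lra.
  rewrite normrM (ger0_norm k0) mulrC /increment_density ler_wpM2l//.
  by apply: le_trans (gP _ _) _; rewrite distrC.
Unshelve. all: by end_near. Qed.

Lemma increment_upper f x : H_ omega f ->
  (`|conj_fun f (x + 2 * h) - conj_fun f x|%:E <=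
   (2 / pi)%:E * \int[mu]_(u in `]0%R, h[) (increment_density u)%:E)%E.
Proof.
move=> Hf; have p0 := pi_gt0 R.
have -> : conj_fun f (x + 2 * h) - conj_fun f x =
    2 / pi * (pi * conj_fun (symmetrization f (x + h)) h).
  rewrite -[in RHS]mulrA (mulrA pi^-1) mulVf ?gt_eqF// mul1r.
  by rewrite -conj_fun_symmetrization// addrK mulr_natl mulr2n addrA.
have t0 : 0 < 2 / pi :> R by rewrite divr_gt0.
rewrite normrM (gtr0_norm t0) EFinM lee_pmul2l ?lte_fin//.
apply: norm_conj_fun_even_le; first exact: H_symmetrization.
exact: symmetrization_even.
Qed.

Hypothesis omega_concave : concave_on `[0, +oo[ omega.

(** The witness is extremal for the approximation of [omega] with mesh
    [pi / n.+1]; the error term comes from [omega - omega eta <= w]. *)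
Lemma extremal_near_lower (d : R) (n : nat) : 0 <= d < h ->
  exists2 f, H_ omega f &
    Int 0 d increment_density - omega (pi / n.+1%:R) * Int 0 d (kern h) <=
    pi / 2 * `|conj_fun f h - conj_fun f (- h)|.
Proof.
move=> d0h; have p0 := pi_gt0 R.
have eta0 : 0 < pi / n.+1%:R :> R by rewrite divr_gt0.
have nE : n.+1%:R * (pi / n.+1%:R) = pi :> R by rewrite mulrC divfK.
have [||w [lw wle wge]] := @concave_min_approximation _ _ omega_modulus omega_concave
  (layered h) pi _ (layered0 h) _ eta0 n.
- by move=> v a c lv a0 c0; exact: layeredD.
- by rewrite nE.
rewrite nE in wge.
have [f [Hf ef fw]] := extremal_function h0pi omega_modulus lw wle.
exists f => //; have [_ fP] := (H_P omega_modulus _).1 Hf.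
have cf := modulated_continuous omega_modulus fP.
have -> : conj_fun f h - conj_fun f (- h) = 2 * conj_fun f h.
  have := conj_fun_symmetrization 0 h Hf; rewrite add0r sub0r => ->.
  congr (2 * conj_fun _ h); apply/funext => u.
  by rewrite /symmetrization add0r sub0r ef; field.
have gap u : 0 <= u < h -> 0 <= partner h u - u <= pi.
  by move=> u0; have := partner_gt h0pi u0; have := @partner_le _ _ h0pi u ltac:(lrah); lrah.
have ck : continuous_on 0 d (kern h) by move=> u ?; apply: continuous_kern_left => //; lra.
have ci : continuous_on 0 d increment_density.
  by move=> u ?; apply: continuous_increment_density; lra.
have step1 : Int 0 d increment_density - omega (pi / n.+1%:R) * Int 0 d (kern h) <=
    Int 0 d (fun u => (f u - f (partner h u)) * kern h u).
  rewrite -IntZ// -IntB//; last first.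
    by apply: continuous_onM => //; apply: continuous_onT; exact: cst_continuous.
  apply: le_Int; last first.
  - move=> u u0; have u0h : 0 <= u < h by lra.
    have k0 := kern_ge0 h0pi u0h; have gu := gap u u0h; have := wge _ gu.
    rewrite fw// /increment_density ger0_norm; last by case/andP: gu.
    by move=> /(ler_wpM2r k0); lra.
  - by apply: continuous_pairing_diff => //; case/andP: d0h.
  - move=> u u0; apply: cvgB; first exact: ci.
    by apply: cvgM; [exact: cvg_cst|exact: ck].
apply: le_trans step1 _; apply: (@le_trans _ _ (pi * conj_fun f h)); last first.
  rewrite normrM gtr0_norm// mulrA divfK// ler_wpM2l ?(ltW p0)//; exact: ler_norm.
apply: (closed_cvg [set y : R | _ <= y] _ _ _ (cvg_conj_pairing Hf ef)).
  exact: closed_ge.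
near=> e; rewrite /=.
have e0 : 0 < e by near: e; exact: nbhs_right_gt.
have ed : e <= h - d by near: e; apply: nbhs_right_le; lra.
rewrite (@Int_cat _ 0 d (h - e)); [|lra|lra|]; last first.
  by apply: continuous_pairing_diff => //; lra.
rewrite lerDl; apply: Int_ge0 => u u0; have u0h : 0 <= u < h by lra.
rewrite mulr_ge0 ?kern_ge0// fw//; have gu := gap u u0h.
have [F [F1 F2]] := lw; rewrite -F2//.
have /andP[gu0 _] := gu; rewrite subr_ge0 in gu0.
by have /andP[] := F1 _ _ gu0.
Unshelve. all: by end_near. Qed.

Lemma increment_lower (s : R) :
  (forall f, H_ omega f -> `|conj_fun f h - conj_fun f (- h)| <= s) ->
  (\int[mu]_(u in `]0%R, h[) (increment_density u)%:E <= (pi / 2 * s)%:E)%E.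
Proof.
move=> sP; have p0 := pi_gt0 R; apply: open_integral_le.
- by lrah.
- by move=> u ?; apply: continuous_increment_density; lra.
- by move=> u ?; apply: increment_density_ge0; lra.
move=> c d c0 cd dh.
have ci : continuous_on 0 d increment_density.
  by move=> u ?; apply: continuous_increment_density; lra.
apply: (@le_trans _ _ (Int 0 d increment_density)).
  rewrite (@Int_cat _ 0 c d)//; last lra.
  by rewrite lerDr; apply: Int_ge0 => u ?; apply: increment_density_ge0; lra.
apply/ler_addgt0Pr => e e0.
have A0 : 0 <= Int 0 d (kern h) by apply: Int_ge0 => u ?; apply: kern_ge0 => //; lra.
set A := Int 0 d (kern h) in A0.
have A1 : 0 < A + 1 by lra.
have [r r0 rP] := @modulus_small _ _ omega_modulus (e / (A + 1)) (divr_gt0 e0 A1).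
have [n _ /(_ n (leqnn n))] := near_infty_natSinv_lt (PosNum (divr_gt0 r0 p0)).
rewrite /= ltr_pdivlMr// => nr.
have [f Hf] := @extremal_near_lower d n ltac:(lra).
have := ler_wpM2l (divr_ge0 (ltW p0) (ler0n R 2)) (sP f Hf).
have om : omega (pi / n.+1%:R) <= e / (A + 1).
  by apply: rP; [rewrite divr_ge0// ltW|rewrite mulrC ltW].
have := ler_wpM2r A0 om; rewrite -/A.
have : e / (A + 1) * A <= e.
  by rewrite mulrAC ler_pdivrMr// ler_pM2l//; lra.
lra.
Qed.

End fixed_h.
End increment.

(** * Suprema of the conjugate functions and the theorem *)

Section sup_norm.
Context {R : realType}.
Variable omega : R -> R.
Hypothesis omega_modulus : modulus_of_continuity omega.
Hypothesis omega_dini : exists2 eps : R, 0 < eps &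
      (\int[lebesgue_measure]_(t in `]0%R, eps[) (omega t / t)%:E < +oo)%E.
Implicit Types (f g : R -> R) (s t x y u c : R).

Definition conj_density s := omega `|2 * s| / sin s.

Lemma continuous_conj_density s : 0 < s < pi -> {for s, continuous conj_density}.
Proof.
move=> s0; apply: cvgM.
  apply: (@continuous_comp _ _ _ (fun s => 2 * s) (fun s => omega `|s|)).
    by apply: cvgM; [exact: cvg_cst|exact: cvg_id].
  exact: (continuous_modulus_norm omega_modulus).
by apply: cvgV; [rewrite gt_eqF// sin_gt0_pi|exact: continuous_sin].
Qed.

Lemma conj_density_ge0 s : 0 < s < pi -> 0 <= conj_density s.
Proof.
move=> s0; rewrite divr_ge0 ?(modulus_ge0 omega_modulus)//.
by rewrite ltW// sin_gt0_pi.
Qed.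

(** Half cotangent plus half tangent: [cos / (2 sin) + sin / (2 cos)] at [s / 2]. *)
Lemma half_cotD s : 0 < s < pi -> half_cot s + half_cot (pi - s) = (sin s)^-1.
Proof.
move=> s0; rewrite half_cotBpi /half_cot.
have sE : sin s = 2 * (sin (s / 2) * cos (s / 2)).
  rewrite {1}(_ : s = s / 2 + s / 2); last by field.
  by rewrite sinD; ring.
have s1 : 0 < sin (s / 2) by apply: sin_half_gt0; lra.
have c1 : 0 < cos (s / 2) by apply: cos_half_gt0; lra.
have {}sE : (sin s)^-1 =
    (cos (s / 2) ^+ 2 + sin (s / 2) ^+ 2) / (2 * (sin (s / 2) * cos (s / 2))).
  by rewrite cos2Dsin2 mul1r sE.
by rewrite sE; field; rewrite !gt_eqF.
Qed.

(** Truncating also at [pi - d] costs nothing in the limit and makes the domain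
    symmetric under [s |-> pi - s].  Both [s] and [pi - s] give differences of
    [f] over a distance [2 * s], the second one after a translation by the period. *)
Lemma conj_fun_upper f x : H_ omega f ->
  (`|conj_fun f x|%:E <= (pi^-1)%:E *
    \int[mu]_(s in `]0%R, (pi / 2)%R[) (conj_density s)%:E)%E.
Proof.
move=> Hf; have [pf fP] := (H_P omega_modulus _).1 Hf; have p0 := pi_gt0 R.
have cf := modulated_continuous omega_modulus fP.
have cs (a b : R) := @continuous_sym_diff R f x a b cf.
suff : (`|- pi * conj_fun f x|%:E <=
    \int[mu]_(s in `]0%R, (pi / 2)%R[) (conj_density s)%:E)%E.
  have -> : `|conj_fun f x| = pi^-1 * `|- pi * conj_fun f x|.
    by rewrite normrM normrN (gtr0_norm p0) mulrA mulVf ?mul1r ?gt_eqF.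
  by rewrite EFinM lee_pmul2l ?lte_fin ?invr_gt0.
have [B B0 BP] := continuous_on_bounded (cs (pi / 2) pi ltac:(lra) (lexx pi)).
have lim0 : Int (pi - d) pi (sym_diff f x) @[d --> 0^'+] --> 0.
  apply/cvgrPdist_le => e e0; near=> d.
  have d0 : 0 < d by near: d; exact: nbhs_right_gt.
  have dpi : d <= pi / 2 by near: d; apply: nbhs_right_le; lra.
  have de : d <= e / (B + 1) by near: d; apply: nbhs_right_le; rewrite divr_gt0//; lra.
  rewrite sub0r normrN.
  have dp : pi - d <= pi by lra.
  have := normr_Int_le_cst (M := B) dp (cs (pi - d) pi ltac:(lra) (lexx pi)).
  rewrite ler_pdivlMr in de; last lra.
  have H s : pi - d <= s <= pi -> `|sym_diff f x s| <= B.
    by move=> ?; apply: BP; lra.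
  by move=> /(_ H); lra.
have lim : Int d pi (sym_diff f x) - Int (pi - d) pi (sym_diff f x) @[d --> 0^'+]
    --> - pi * conj_fun f x - 0.
  by apply: cvgB => //; exact: (cvg_sym_diff omega_modulus omega_dini).
rewrite -[X in (`|X|%:E)%E]subr0; apply: (norm_lim_le lim); near=> d.
have d0 : 0 < d by near: d; exact: nbhs_right_gt.
have dpi : d < pi / 2 by near: d; apply: nbhs_right_lt; lra.
have cd : continuous_on d (pi / 2) conj_density.
  by move=> s ?; apply: continuous_conj_density; lra.
apply: (@le_trans _ _ (Int d (pi / 2) conj_density)%:E); last first.
  apply: Int_le_open_integral => //.
  - by move=> s ?; apply: continuous_conj_density; lra.
  - by move=> s ?; apply: conj_density_ge0; lra.
rewrite lee_fin (@Int_cat _ d (pi - d) pi); [|lra|lra|exact: cs]; rewrite addrK.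
rewrite (@Int_cat _ d (pi / 2) (pi - d)); [|lra|lra|apply: cs; lra].
rewrite (@Int_reflectE _ pi d (pi / 2) (pi / 2) (pi - d)); [|lra|lra|lra|apply: cs; lra].
have cr : continuous_on d (pi / 2) (fun s => sym_diff f x (pi - s)).
  move=> s sd; apply: (@continuous_comp _ _ _ (fun s => pi - s) (sym_diff f x)).
    by apply: cvgB; [exact: cvg_cst|exact: cvg_id].
  by apply: (cs (pi - s) (pi - s)); lra.
rewrite -IntD//; last by apply: cs; lra.
apply: normr_Int_le => //.
  by move=> s sd; apply: cvgD; [apply: (cs d (pi / 2)); lra|exact: cr].
move=> s sd.
have k1 : 0 <= half_cot s by apply: half_cot_ge0; lra.
have k2 : 0 <= half_cot (pi - s) by apply: half_cot_ge0; lra.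
have f1 : `|f (x + s) - f (x - s)| <= omega `|2 * s|.
  by apply: le_trans (fP _ _) _; rewrite (_ : _ - _ = 2 * s)//; ring.
have f2 : `|f (x + (pi - s)) - f (x - (pi - s))| <= omega `|2 * s|.
  rewrite (_ : x + (pi - s) = x - pi - s + pi *+ 2); last by ring.
  rewrite pf; apply: le_trans (fP _ _) _.
  by rewrite distrC (_ : _ - _ = 2 * s)//; ring.
rewrite /conj_density -half_cotD; last lra.
rewrite mulrDr; apply: le_trans (ler_normD _ _) _; rewrite /sym_diff.
rewrite [X in X + _ <= _]normrM [X in _ + X <= _]normrM.
by rewrite (ger0_norm k1) (ger0_norm k2) lerD// ler_wpM2r.
Unshelve. all: by end_near. Qed.

(** For [h = pi / 2] the half-angle tangent of [h] is 1. *)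
Lemma partner_pihalf u : 0 <= u <= pi / 2 -> partner (pi / 2) u = pi - u.
Proof.
move=> u0; have p0 := pi_gt0 R.
rewrite /partner (_ : pi / 2 / 2 = pi / 4); last by field.
rewrite tan_piquarter expr1n divr1 tanK; first by field.
by rewrite in_itv/=; lra.
Qed.

Hypothesis omega_concave : concave_on `[0, +oo[ omega.

Lemma conj_fun_lower s :
  (forall f, H_ omega f -> forall x, `|conj_fun f x| <= s) ->
  (\int[mu]_(s in `]0%R, (pi / 2)%R[) (conj_density s)%:E <= (pi * s)%:E)%E.
Proof.
move=> sP; have p0 := pi_gt0 R; have hpi : 0 < (pi / 2 : R) < pi by lra.
have := @increment_lower _ _ omega_modulus omega_dini _ hpi omega_concave (2 * s).
rewrite (_ : pi / 2 * (2 * s) = pi * s); last by field.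
have H : forall f, H_ omega f -> `|conj_fun f (pi / 2) - conj_fun f (- (pi / 2))| <= 2 * s.
  move=> f Hf; apply: le_trans (ler_normB _ _) _.
  by have := sP f Hf (pi / 2); have := sP f Hf (- (pi / 2)); lra.
move=> /(_ H) IP; apply: open_integral_le; first by lra.
- by move=> x ?; apply: continuous_conj_density; lra.
- by move=> x ?; apply: conj_density_ge0; lra.
move=> c d c0 cd dpi; rewrite -lee_fin; apply: le_trans IP.
have ci : continuous_on (pi / 2 - d) (pi / 2 - c) (increment_density omega (pi / 2)).
  by move=> u ?; apply: continuous_increment_density => //; lra.
rewrite (@eq_Int _ c d _
  (fun t => increment_density omega (pi / 2) (pi / 2 - t))); last first.
  move=> t tcd; rewrite /conj_density /increment_density partner_pihalf; last lra.
  rewrite /kern sin_pihalf cos_pihalf subr0 div1r -(opprB t) cosN cosBpihalf.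
  by rewrite mulrC (_ : pi - _ - _ = 2 * t)//; field.
rewrite (_ : Int c d _ =
  Int (pi / 2 - d) (pi / 2 - c) (increment_density omega (pi / 2))).
  apply: Int_le_open_integral; [by lra|by lra|exact: ci| |] => u ?.
    by apply: continuous_increment_density => //; lra.
  by apply: increment_density_ge0 => //; lra.
by rewrite Int_reflect.
Qed.

End sup_norm.

Section suprema.
Context {R : realType}.
Implicit Types (f : R -> R).

(** The lower bound is only asked for real bounds [s]: an infinite supremum
    dominates everything. *)
Lemma ereal_sup_max_abs (A : set (R -> R)) (T : (R -> R) -> R -> R) (k : R) (J : \bar R) :
  A !=set0 -> 0 < k ->
  (forall f, A f -> forall x, (`|T f x|%:E <= k%:E * J)%E) ->
  (forall s, (forall f, A f -> forall x, `|T f x| <= s) -> (J <= (k^-1 * s)%:E)%E) ->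
  ereal_sup [set max_abs (T f) | f in A] = (k%:E * J)%E.
Proof.
move=> [f0 Af0] k0 ub lb; apply/eqP; rewrite eq_le; apply/andP; split.
  apply: ge_ereal_sup => _ [f Af <-].
  by apply: ge_ereal_sup => _ [x _ <-]; exact: ub.
set S := ereal_sup _.
have SP f x : A f -> (`|T f x|%:E <= S)%E.
  move=> Af; apply: (@le_trans _ _ (max_abs (T f))).
    by apply: ereal_sup_ubound; exists x.
  by apply: ereal_sup_ubound; exists f.
case: S SP => [s| |] SP.
- apply: (@le_trans _ _ (k%:E * (k^-1 * s)%:E)%E).
    by rewrite lee_pmul2l ?lte_fin// lb// => f Af x; rewrite -lee_fin SP.
  by rewrite -EFinM mulrA divff ?mul1r// gt_eqF.
- by rewrite leey.
- by have := SP f0 0 Af0.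
Qed.

Lemma H_cst0 (omega : R -> R) : modulus_of_continuity omega -> H_ omega (cst 0).
Proof.
move=> om; apply/(H_P om); split => // x y.
by rewrite /cst subrr normr0 (modulus_ge0 om).
Qed.

End suprema.

Theorem theorem1 (R : realType) (omega : R -> R)
    (omega_modulus : modulus_of_continuity omega)
    (omega_concave : concave_on `[0, +oo[ omega)
    (omega_dini : exists2 eps : R, 0 < eps &
      (\int[lebesgue_measure]_(t in `]0%R, eps[) (omega t / t)%:E < +oo)%E) :
  [/\
    (* the conjugate functions and the maxima below are well defined *)
    forall f, H_ omega f ->
      [/\ forall x, cvg (conj_trunc f x delta @[delta --> 0^'+]),
          max_abs_attained (conj_fun f) &
          forall t, 0 < t < 2 * pi ->
            max_abs_attained (fun x => conj_fun f (x + t) - conj_fun f x)],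
    ereal_sup [set max_abs (conj_fun f) | f in H_ omega] =
      ((pi^-1)%:E *
       \int[lebesgue_measure]_(t in `]0%R, (pi / 2)%R[)
         (omega (2 * t) / sin t)%:E)%E &
    forall t, 0 < t < 2 * pi ->
      (* rho is well defined *)
      (forall x, 0 < x < t / 2 -> exists! r, rho_spec t x r) /\
      forall rho : R -> R,
        (forall x, 0 < x < t / 2 -> rho_spec t x (rho x)) ->
        ereal_sup [set max_abs (fun x => conj_fun f (x + t) - conj_fun f x)
                  | f in H_ omega] =
          ((2 / pi)%:E *
           \int[lebesgue_measure]_(u in `]0%R, (t / 2)%R[)
             (diff_kernel t u * omega (rho u - u))%:E)%E].
Proof.
have p0 := pi_gt0 R.
have H0 : H_ omega !=set0 by exists (cst 0); exact: H_cst0.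
split=> [f Hf||t t0].
- have [pf fP] := (H_P omega_modulus _).1 Hf.
  have cc := conj_fun_continuous omega_modulus omega_dini fP.
  have cp := conj_fun_periodic omega_modulus omega_dini fP pf.
  split=> [x||t t0].
  + exact: (cvg_conj_trunc omega_modulus omega_dini).
  + exact: max_abs_attained_periodic.
  + apply: max_abs_attained_periodic => [x|x].
      apply: cvgB; last exact: cc.
      apply: (@continuous_comp _ _ _ (fun x => x + t) (conj_fun f)); last exact: cc.
      by apply: cvgD; [exact: cvg_id|exact: cvg_cst].
    by rewrite (addrAC x) !cp.
- rewrite (@ereal_sup_max_abs _ _ _ pi^-1
      (\int[lebesgue_measure]_(s in `]0%R, (pi / 2)%R[) (conj_density omega s)%:E)%E)//.
  + congr (_ * _)%E; apply: eq_integral => s; rewrite inE/= in_itv/= => s0.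
    by rewrite /conj_density ger0_norm//; lra.
  + by rewrite invr_gt0.
  + by move=> f Hf x; exact: (conj_fun_upper omega_modulus omega_dini).
  + move=> s sP; rewrite invrK.
    exact: (conj_fun_lower omega_modulus omega_dini omega_concave).
split=> [x x0|rho rhoP].
  exists (partner (t / 2) x); split; first exact: rho_spec_partner.
  by move=> r rP; apply: (rho_spec_unique t0 _ rP); exact: rho_spec_partner.
have hpi : 0 < t / 2 < pi by lra.
rewrite (@ereal_sup_max_abs _ _ _ (2 / pi)
  (\int[lebesgue_measure]_(u in `]0%R, (t / 2)%R[)
     (increment_density omega (t / 2) u)%:E)%E)//.
- congr (_ * _)%E; apply: eq_integral => u; rewrite inE/= in_itv/= => u0.
  rewrite (rho_spec_unique t0 (rhoP u u0) (rho_spec_partner t0 u0)).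
  rewrite /increment_density ger0_norm// subr_ge0.
  have := @partner_gt _ _ hpi u ltac:(lra); lra.
- by rewrite divr_gt0.
- move=> f Hf x.
  have := increment_upper omega_modulus omega_dini hpi x Hf.
  by rewrite (_ : x + 2 * (t / 2) = x + t)//; field.
- move=> s sP; rewrite invf_div.
  apply: (increment_lower omega_modulus omega_dini hpi omega_concave) => f Hf.
  have := sP f Hf (- (t / 2)).
  by rewrite (_ : - (t / 2) + t = t / 2)//; field.
Qed.
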